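(* Let $k$ be an algebraically closed field of characteristic zero. (i) For $H$ a finite-dimensional factorizable ribbon Hopf algebra over $k$ and $\omega$ a Hopf algebra automorphism of $H$, the bimodule $F_\omega$ (the coregular bimodule with right action twisted by $\omega$) carries the structure of a Frobenius algebra in $H\text{-Bimod}$. Its structure morphisms $m_F,\eta_F,\Delta_F,\varepsilon_F$ are given, as linear maps, by $$m_F(p\otimes q)(x)=p(x_{(2)})\,q(x_{(1)}),\qquad \eta_F(1)=\varepsilon,\qquad \sum p'(y)\,p''(x)=p(x_{(1)})\,\lambda(\mathsf s(x_{(2)})\,y)\ \text{ for }\ \Delta_F(p)=\sum p'\otimes p'',\qquad \varepsilon_F(p)=p(\Lambda)$$ for $p,q\in H^*$ and $x,y\in H$ (these are the same linear maps as for $\omega=\mathrm{id}_H$). (ii) $F_\omega$ is commutative and symmetric, and it is special if and only if $H$ is semisimple. (iii) If $\omega$ is a ribbon Hopf algebra automorphism, then $F_\omega$ is modular invariant, i.e. the morphism $t_{\mathcal Q}(\Delta_F)\in\mathrm{Hom}_{H|H}(K,F_\omega)$ is $\Gamma_{1;1}$-invariant.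
   Context: **Hopf algebra conventions.** $H=(H,m,\eta,\Delta,\varepsilon,\mathsf s)$ is a Hopf algebra over $k$ with antipode $\mathsf s$ and Sweedler notation $\Delta(h)=h_{(1)}\otimes h_{(2)}$; $\otimes=\otimes_k$; $H^*=\mathrm{Hom}_k(H,k)$. Quasitriangular: endowed with an invertible $R\in H\otimes H$ with $\Delta^{\mathrm{op}}(h)=R\,\Delta(h)R^{-1}$, $(\Delta\otimes\mathrm{id})(R)=R_{13}R_{23}$, $(\mathrm{id}\otimes\Delta)(R)=R_{13}R_{12}$. Monodromy matrix: $Q=R_{21}R$. Ribbon: endowed moreover with a central invertible $v\in H$ with $\mathsf s(v)=v$, $\varepsilon(v)=1$, $\Delta(v)=(v\otimes v)Q^{-1}$. Factorizable: $Q=\sum_\ell h_\ell\otimes k_\ell$ with $\{h_\ell\}$, $\{k_\ell\}$ two vector space bases of $H$. With $R=\sum_i r_i\otimes s_i$ put $u=\sum_i \mathsf s(s_i)r_i$ and $t=uv^{-1}$ (a group-like element). A Hopf algebra automorphism of $H$ is an algebra and coalgebra automorphism commuting with $\mathsf s$; it is a ribbon Hopf algebra automorphism if in addition $(\omega\otimes\omega)(R)=R$ and $\omega(v)=v$. **(Co)integrals.** $H$ is unimodular; $\Lambda\in H$ is a non-zero two-sided integral ($h\Lambda=\varepsilon(h)\Lambda=\Lambda h$) and $\lambda\in H^*$ a non-zero right cointegral ($\lambda(h_{(1)})h_{(2)}=\lambda(h)1$), normalized (uniquely up to a common sign) such that $\lambda(\Lambda)=1$ and $(\lambda\otimes\mathrm{id})(Q)=\Lambda$.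 **The category $H$-Bimod.** Objects are finite-dimensional $H$-bimodules; $\mathrm{Hom}_{H|H}$ denotes bimodule morphisms. The tensor product is $X\otimes_k Y$ with $h.(x\otimes y)=h_{(1)}.x\otimes h_{(2)}.y$ and $(x\otimes y).h=x.h_{(1)}\otimes y.h_{(2)}$; the unit is $k$ with both actions given by $\varepsilon$. The braiding is $c_{X,Y}(x\otimes y)=R^{-1}.(y\otimes x).R$ (left action of $R^{-1}$ and right action of $R$, factorwise). The twist is $\theta_X(x)=v.x.v^{-1}$. **Algebras.** A Frobenius algebra $A$ is an object with a (unital associative) algebra structure $(m_A,\eta_A)$ and a (counital coassociative) coalgebra structure $(\Delta_A,\varepsilon_A)$, all structure maps being morphisms of the category, such that $(m_A\otimes\mathrm{id}_A)\circ(\mathrm{id}_A\otimes\Delta_A)=\Delta_A\circ m_A=(\mathrm{id}_A\otimes m_A)\circ(\Delta_A\otimes\mathrm{id}_A)$. It is commutative if $m_A\circ c_{A,A}=m_A$. It is symmetric (in $H\text{-Bimod}$) if the invariant pairing $\kappa=\varepsilon_A\circ m_A$ satisfies $\kappa(a\otimes b)=\kappa(b\otimes t.a.t)$ for all $a,b\in A$ (equivalently $\kappa(a\otimes b)=\kappa(t^{-1}.b.t^{-1}\otimes a)$). It is special if $\varepsilon_A\circ\eta_A=\xi\,\mathrm{id}_{\mathbf 1}$ and $m_A\circ\Delta_A=\zeta\,\mathrm{id}_A$ with $\xi,\zeta\in k^\times$. **The bimodule $F_\omega$.** As a vector space $F_\omega=H^*$, with actions $(h.p)(x)=p(\mathsf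 s(h)x)$ and $(p.h)(x)=p(x\,\mathsf s^{-1}(\omega(h)))$. **The bimodule $K$.** $K=H^*\otimes H^*$, regarded as linear forms $f$ on $H\otimes H$, with $(h.f)(a\otimes b)=f(\mathsf s(h_{(1)})\,a\,h_{(2)}\otimes b)$ and $(f.h)(a\otimes b)=f(a\otimes h_{(2)}\,b\,\mathsf s^{-1}(h_{(1)}))$. **Partial monodromy trace.** Write $Q=\sum q_1\otimes q_2$ and $Q^{-1}=\sum \bar q_1\otimes\bar q_2$. For $f\in K$ and $x$ in a bimodule $X$ put $f\triangleright x:=\sum f(\bar q_1\otimes q_1)\;\bar q_2.x.q_2$. For $g\in\mathrm{Hom}_{H|H}(X,Y\otimes X)$ the morphism $t_{\mathcal Q}(g)\in\mathrm{Hom}_{H|H}(K,Y)$ is $t_{\mathcal Q}(g)(f)=\sum_i(\mathrm{id}_Y\otimes\varphi^i)\big(g(f\triangleright e_i)\big)$ with $\varphi^i(x)=e^i(t.x.t)$, where $\{e_i\}$ is a basis of $X$ and $\{e^i\}$ the dual basis. **Action of $\Gamma_{1;1}$.** The mapping class group $\Gamma_{1;1}$ of the one-punctured torus is generated by $S,T,D$ subject to $(ST)^3=S^2$, $S^4=D$. On $\mathrm{Hom}_{H|H}(K,X)$ the generators act by $g\mapsto g\circ S_K^{-1}$, $g\mapsto g\circ T_K^{-1}$ and $g\mapsto\theta_X\circ g$, respectively, where $S_K,T_K\in\mathrm{End}_{H|H}(K)$ are the invertible endomorphisms $S_K(f)(a\otimes b)=\sum f(\bar q_1\otimes q_1)\,\lambda(\mathsf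 s(\bar q_2)\,a)\,\lambda(b\,\mathsf s^{-1}(q_2))$ and $T_K(f)(a\otimes b)=f(va\otimes b\,v^{-1})$. Invariance of $g$ means that $g$ is fixed by all three generators.
   Formalization: In (ii), ''commutative and symmetric'' is proved only for ribbon Hopf algebra automorphisms ω; for a general Hopf automorphism it is false (commutativity forces (ω⊗ω)(R)=R, symmetry forces ω(t)=t), e.g. H=k[Z/5], ω(g)=g². *)

(* Defs.v *)
From HB Require Import structures.
From mathcomp Require Import all_boot all_order all_algebra all_field.

Set Implicit Arguments.
Unset Strict Implicit.
Unset Printing Implicit Defensive.

Import GRing.Theory.
Local Open Scope ring_scope.

(** * Tensor products of finite-dimensional vector spaces

    [U ⊗ V] is modelled by matrices of coordinates with respect to the library
    bases [vbasis fullv] of [U] and [V].  Only [tens], [tlift] and their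
    combinations are used below: [tlift f] is the linear extension of a
    bilinear [f], so that [tlift f z] reads [Σ f z' z''] for [z = Σ z' ⊗ z'']
    ([tlift_tens], [tensor_ind]). *)

Definition tensor (k : fieldType) (U V : vectType k) : vectType k :=
  'M[k]_(\dim (@fullv k U), \dim (@fullv k V)).

Notation "U ⊗ V" := (tensor U V) (at level 40, left associativity).

Section Tensor.
Variable k : fieldType.
Implicit Types U V W : vectType k.

Definition tens U V (x : U) (y : V) : U ⊗ V :=
  \matrix_(i, j) (coord (vbasis fullv) i x * coord (vbasis fullv) j y).

Definition tlift U V W (f : U -> V -> W) (z : U ⊗ V) : W :=
  \sum_(i < \dim (@fullv k U)) \sum_(j < \dim (@fullv k V))
    (z : 'M[k]_(_, _)) i j *: f (vbasis fullv)`_i (vbasis fullv)`_j.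

Definition tlinfun U V W (f : U -> V -> W) : 'Hom(U ⊗ V, W) :=
  linfun (tlift f).

Definition tmap U V U' V' (f : U -> U') (g : V -> V') : U ⊗ V -> U' ⊗ V' :=
  tlift (fun x y => tens (f x) (g y)).

Definition tflip U V : U ⊗ V -> V ⊗ U := tlift (fun x y => tens y x).

Definition tassoc U V W : U ⊗ V ⊗ W -> U ⊗ (V ⊗ W) :=
  tlift (fun w z => tlift (fun x y => tens x (tens y z)) w).

Definition tassocV U V W : U ⊗ (V ⊗ W) -> U ⊗ V ⊗ W :=
  tlift (fun x w => tlift (fun y z => tens (tens x y) z) w).

Definition bilinear_map U V W (f : U -> V -> W) : Prop :=
  (forall y a x x', f (a *: x + x') y = a *: f x y + f x' y) /\
  (forall x a y y', f x (a *: y + y') = a *: f x y + f x y').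

Lemma tens_bilinear U V : bilinear_map (@tens U V).
Proof.
split=> [y a x x'|x a y y']; apply/matrixP=> i j; rewrite !mxE linearP /=.
  by rewrite mulrDl mulrA.
by rewrite mulrDr mulrCA.
Qed.

Lemma tlift_is_linear U V W (f : U -> V -> W) : linear (tlift f).
Proof.
move=> a z z'; rewrite /tlift scaler_sumr -big_split; apply: eq_bigr => i _ /=.
rewrite scaler_sumr -big_split; apply: eq_bigr => j _ /=.
by rewrite !mxE scalerDl scalerA.
Qed.

HB.instance Definition _ U V W (f : U -> V -> W) :=
  GRing.isSemilinear.Build k (U ⊗ V) W _ (tlift f)
    (GRing.semilinear_linear (tlift_is_linear f)).

Lemma tlift_tens U V W (f : U -> V -> W) (x : U) (y : V) :
  bilinear_map f -> tlift f (tens x y) = f x y.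
Proof.
case=> fl fr.
have f0l v : f 0 v = 0 by have:= fl v (-1) 0 0; rewrite scaler0 add0r scaleN1r addNr.
have f0r u : f u 0 = 0 by have:= fr u (-1) 0 0; rewrite scaler0 add0r scaleN1r addNr.
have suml n (c : 'I_n -> k) (e : 'I_n -> U) v :
    f (\sum_i c i *: e i) v = \sum_i c i *: f (e i) v.
  have fD : {morph f^~ v : x1 x2 / x1 + x2} by move=> x1 x2; have:= fl v 1 x1 x2; rewrite !scale1r.
  rewrite (big_morph (f^~ v) fD (f0l v)); apply: eq_bigr => i _.
  by have:= fl v (c i) (e i) 0; rewrite !addr0 f0l addr0.
have sumr n (c : 'I_n -> k) (e : 'I_n -> V) u :
    f u (\sum_i c i *: e i) = \sum_i c i *: f u (e i).
  have fD : {morph f u : y1 y2 / y1 + y2} by move=> y1 y2; have:= fr u 1 y1 y2; rewrite !scale1r.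
  rewrite (big_morph (f u) fD (f0r u)); apply: eq_bigr => i _.
  by have:= fr u (c i) (e i) 0; rewrite !addr0 f0r addr0.
rewrite [in RHS](coord_vbasis (memvf x)) suml; apply: eq_bigr => i _.
rewrite [in RHS](coord_vbasis (memvf y)) sumr scaler_sumr.
by apply: eq_bigr => j _; rewrite mxE scalerA.
Qed.

Lemma tlinfunE U V W (f : U -> V -> W) (x : U) (y : V) :
  bilinear_map f -> tlinfun f (tens x y) = f x y.
Proof. by move=> bf; rewrite lfunE /= tlift_tens. Qed.

Lemma eq_tlift U V W (f g : U -> V -> W) z :
  (forall x y, f x y = g x y) -> tlift f z = tlift g z.
Proof.
by move=> fg; apply: eq_bigr => i _; apply: eq_bigr => j _; rewrite fg.
Qed.

Lemma tliftP U V W (f g : U -> V -> W) a z :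
  tlift (fun x y => a *: f x y + g x y) z = a *: tlift f z + tlift g z.
Proof.
rewrite /tlift scaler_sumr -big_split; apply: eq_bigr => i _ /=.
rewrite scaler_sumr -big_split; apply: eq_bigr => j _ /=.
by rewrite scalerDr !scalerA mulrC.
Qed.

Lemma tensor_ind U V (P : U ⊗ V -> Prop) :
  P 0 -> (forall z w, P z -> P w -> P (z + w)) ->
  (forall x y, P (tens x y)) -> forall z, P z.
Proof.
move=> P0 PD PT z.
have -> : z = \sum_i \sum_j
    tens ((z : 'M[k]_(_, _)) i j *: (vbasis fullv)`_i) (vbasis fullv)`_j.
  apply/matrixP=> i j; rewrite summxE (bigD1 i) //= summxE (bigD1 j) //=.
  have fU : free (vbasis (@fullv k U)) by apply: basis_free (vbasisP _).
  have fV : free (vbasis (@fullv k V)) by apply: basis_free (vbasisP _).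
  rewrite mxE linearZ /= !coord_free // !eqxx !mulr1.
  rewrite big1 => [|j' nj]; last first.
    by rewrite mxE (coord_free _ _ fV) [_ == _](negPf nj) mulr0.
  rewrite addr0 big1 ?addr0 // => i' ni; rewrite summxE big1 // => j' _.
  by rewrite mxE linearZ /= (coord_free _ _ fU) [_ == _](negPf ni) mulr0 mul0r.
by apply: (big_ind P) => // i _; apply: (big_ind P).
Qed.

End Tensor.

(** * Hopf algebras *)

Definition is_coalgebra (k : fieldType) (C : vectType k)
    (Delta : 'Hom(C, C ⊗ C)) (eps : 'Hom(C, k^o)) : Prop :=
  [/\ forall c, tassoc (tmap Delta id (Delta c)) = tmap id Delta (Delta c),
      forall c, tmap eps id (Delta c) = tens (1 : k^o) c
    & forall c, tmap id eps (Delta c) = tens c (1 : k^o)].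

Section Hopf.
Variables (k : fieldType) (H : falgType k).

Definition tmul (z w : H ⊗ H) : H ⊗ H :=
  tlift (fun a b => tlift (fun c d => tens (a * c) (b * d)) w) z.

Record hopf_algebra := HopfAlgebra {
  comul : 'Hom(H, H ⊗ H);
  counit : 'Hom(H, k^o);
  antipode : 'End(H);
  comul_coalgebra : is_coalgebra comul counit;
  comul1 : comul 1 = tens 1 1;
  comulM : forall a b, comul (a * b) = tmul (comul a) (comul b);
  counit1 : counit 1 = 1;
  counitM : forall a b, counit (a * b) = counit a * counit b;
  antipodel : forall h,
    tlift (fun h1 h2 => antipode h1 * h2) (comul h) = (counit h : k) *: 1;
  antipoder : forall h,
    tlift (fun h1 h2 => h1 * antipode h2) (comul h) = (counit h : k) *: 1 }.

Record quasitriangular (HH : hopf_algebra) := Quasitriangular {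
  Rmx : H ⊗ H;
  Rinv : H ⊗ H;
  RmxV : tmul Rmx Rinv = tens 1 1;
  RmxK : tmul Rinv Rmx = tens 1 1;
  Rmx_op : forall h,
    tflip (comul HH h) = tmul (tmul Rmx (comul HH h)) Rinv;
  (* R_13 R_23 *)
  Rmx_comull : tmap (comul HH) id Rmx =
    tlift (fun r s => tlift (fun r' s' =>
      tens (tens r r') (s * s')) Rmx) Rmx;
  (* R_13 R_12 *)
  Rmx_comulr : tmap id (comul HH) Rmx =
    tlift (fun r s => tlift (fun r' s' =>
      tens (r * r') (tens s' s)) Rmx) Rmx }.

Definition monodromy HH (qt : quasitriangular HH) : H ⊗ H :=
  tmul (tflip (Rmx qt)) (Rmx qt).

Definition monodromyV HH (qt : quasitriangular HH) : H ⊗ H :=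
  tmul (Rinv qt) (tflip (Rinv qt)).

Record ribbon (HH : hopf_algebra) := Ribbon {
  ribbon_qt :> quasitriangular HH;
  rv : H;
  rv_unit : rv \is a GRing.unit;
  rv_central : forall h, rv * h = h * rv;
  rv_antipode : antipode HH rv = rv;
  rv_counit : counit HH rv = 1;
  rv_comul : comul HH rv = tmul (tens rv rv) (monodromyV ribbon_qt) }.

Definition factorizable HH (qt : quasitriangular HH) : Prop :=
  exists b c : (\dim (@fullv k H)).-tuple H,
    [/\ basis_of fullv b, basis_of fullv c
      & monodromy qt = \sum_(l < \dim (@fullv k H)) tens b`_l c`_l].

(* The regular left module is completely reducible. *)
Definition semisimple_algebra : Prop :=
  let left_ideal (U : {vspace H}) := forall h x : H, x \in U -> h * x \in U in
  forall U : {vspace H}, left_ideal U ->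
    exists W : {vspace H},
      [/\ left_ideal W, (U + W)%VS = fullv & (U :&: W)%VS = 0%VS].

Definition is_hopf_aut (HH : hopf_algebra) (om : 'AEnd(H)) : Prop :=
  [/\ bijective om,
      forall h, comul HH (om h) = tmap om om (comul HH h),
      forall h, counit HH (om h) = counit HH h
    & forall h, antipode HH (om h) = om (antipode HH h)].

Definition is_ribbon_aut HH (rb : ribbon HH) (om : 'AEnd(H)) : Prop :=
  [/\ is_hopf_aut HH om, tmap om om (Rmx rb) = Rmx rb & om (rv rb) = rv rb].

Definition drinfeld_u HH (qt : quasitriangular HH) : H :=
  tlift (fun r s => antipode HH s * r) (Rmx qt).

Definition rt HH (rb : ribbon HH) : H := drinfeld_u rb * (rv rb)^-1.

Definition is_integral (HH : hopf_algebra) (L : H) : Prop :=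
  L != 0 /\ forall h, h * L = (counit HH h : k) *: L
                   /\ L * h = (counit HH h : k) *: L.

Definition is_right_cointegral (HH : hopf_algebra)
    (lam : 'Hom(H, k^o)) : Prop :=
  lam != 0 /\ forall h,
    tlift (fun h1 h2 => (lam h1 : k) *: h2) (comul HH h) = (lam h : k) *: 1.

Definition normalized_integrals HH (qt : quasitriangular HH)
    (L : H) (lam : 'Hom(H, k^o)) : Prop :=
  lam L = 1 /\ tlift (fun a b => (lam a : k) *: b) (monodromy qt) = L.

(** * The category of finite-dimensional bimodules *)

(* Raw actions; the bimodule axioms are [is_bimod]. *)
Record bimod := Bimod {
  bsort :> vectType k;
  lact : H -> bsort -> bsort;
  ract : bsort -> H -> bsort }.

Definition is_bimod (X : bimod) : Prop :=
  [/\ bilinear_map (@lact X) /\ bilinear_map (@ract X),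
      forall x : X, lact 1 x = x /\ ract x 1 = x,
      forall a b (x : X), lact (a * b) x = lact a (lact b x),
      forall a b (x : X), ract x (a * b) = ract (ract x a) b
    & forall a b (x : X), ract (lact a x) b = lact a (ract x b)].

Definition is_bimod_hom (X Y : bimod) (f : 'Hom(X, Y)) : Prop :=
  (forall h x, f (lact h x) = lact h (f x)) /\
  (forall h x, f (ract x h) = ract (f x) h).

(* Factorwise actions of H ⊗ H. *)
Definition lact2 (X Y : bimod) (w : H ⊗ H) (z : X ⊗ Y) : X ⊗ Y :=
  tlift (fun a b => tmap (lact a) (lact b) z) w.

Definition ract2 (X Y : bimod) (z : X ⊗ Y) (w : H ⊗ H) : X ⊗ Y :=
  tlift (fun a b => tmap (fun x => ract x a) (fun y => ract y b) z) w.

Definition unit_bimod (HH : hopf_algebra) : bimod :=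
  @Bimod k^o (fun h c => counit HH h * c) (fun c h => c * counit HH h).

Definition tensor_bimod (HH : hopf_algebra) (X Y : bimod) : bimod :=
  @Bimod (X ⊗ Y) (fun h z => lact2 (comul HH h) z)
                 (fun z h => ract2 z (comul HH h)).

Definition braiding HH (qt : quasitriangular HH) (X Y : bimod)
    (z : X ⊗ Y) : Y ⊗ X :=
  lact2 (Rinv qt) (ract2 (tflip z) (Rmx qt)).

Definition twist HH (rb : ribbon HH) (X : bimod) (x : X) : X :=
  ract (lact (rv rb) x) (rv rb)^-1.

(** * Frobenius algebras in the category of bimodules *)

Section Frobenius.
Variables (HH : hopf_algebra) (A : bimod).
Variables (m : 'Hom(A ⊗ A, A)) (eta : 'Hom(k^o, A))
          (Delta : 'Hom(A, A ⊗ A)) (eps : 'Hom(A, k^o)).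

Definition is_frobenius : Prop :=
  [/\ is_bimod A,
      [/\ @is_bimod_hom (tensor_bimod HH A A) A m,
          @is_bimod_hom (unit_bimod HH) A eta,
          @is_bimod_hom A (tensor_bimod HH A A) Delta
        & @is_bimod_hom A (unit_bimod HH) eps],
      [/\ forall z : A ⊗ A ⊗ A,
            m (tmap m id z) = m (tmap id m (tassoc z)),
          forall a : A, m (tmap eta id (tens (1 : k^o) a)) = a
        & forall a : A, m (tmap id eta (tens a (1 : k^o))) = a],
      is_coalgebra Delta eps
    & forall z : A ⊗ A,
        tmap m id (tassocV (tmap id Delta z)) = Delta (m z) /\
        Delta (m z) = tmap id m (tassoc (tmap Delta id z))].

Definition is_commutative (qt : quasitriangular HH) : Prop :=
  forall z : A ⊗ A, m (braiding qt z) = m z.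

Definition is_symmetric (rb : ribbon HH) : Prop :=
  forall a b : A,
    eps (m (tens a b)) = eps (m (tens b (ract (lact (rt rb) a) (rt rb)))).

Definition is_special : Prop :=
  exists xi zeta : k,
    [/\ xi != 0, zeta != 0,
        forall c : k^o, eps (eta c) = xi *: c
      & forall a : A, m (Delta a) = zeta *: a].

End Frobenius.

(** * The bimodules F_ω and K *)

(* [(f^-1)%VF] is the library inverse of a linear map; the antipode of a
   finite-dimensional Hopf algebra is bijective, so it is s^-1 here. *)
Definition antipodeV (HH : hopf_algebra) : 'End(H) := ((antipode HH)^-1)%VF.

Definition Fomega (HH : hopf_algebra) (om : 'AEnd(H)) : bimod :=
  @Bimod 'Hom(H, k^o)
    (fun h p => (p \o amull (antipode HH h))%VF)
    (fun p h => (p \o amulr (antipodeV HH (om h)))%VF).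

Definition Kbimod (HH : hopf_algebra) : bimod :=
  @Bimod 'Hom(H ⊗ H, k^o)
    (fun h f => tlinfun (fun a b =>
       tlift (fun h1 h2 => f (tens (antipode HH h1 * a * h2) b)) (comul HH h)))
    (fun f h => tlinfun (fun a b =>
       tlift (fun h1 h2 => f (tens a (h2 * b * antipodeV HH h1))) (comul HH h))).

Lemma Fomega_lactE HH om h (p : 'Hom(H, k^o)) x :
  (lact h (p : Fomega HH om) : 'Hom(H, k^o)) x = p (antipode HH h * x).
Proof. by rewrite comp_lfunE lfunE. Qed.

Lemma Fomega_ractE HH om h (p : 'Hom(H, k^o)) x :
  (ract (p : Fomega HH om) h : 'Hom(H, k^o)) x = p (x * antipodeV HH (om h)).
Proof. by rewrite comp_lfunE lfunE. Qed.

Lemma Kbimod_lactE HH h (f : 'Hom(H ⊗ H, k^o)) a b :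
  (lact h (f : Kbimod HH) : 'Hom(H ⊗ H, k^o)) (tens a b) =
    tlift (fun h1 h2 => f (tens (antipode HH h1 * a * h2) b)) (comul HH h).
Proof.
have [bl br] := @tens_bilinear k H H.
rewrite tlinfunE //; split=> [y c x x'|x c y y']; rewrite -tliftP;
  apply: eq_tlift => h1 h2; last by rewrite br linearP.
by rewrite mulrDr -scalerAr mulrDl -scalerAl bl linearP.
Qed.

Lemma Kbimod_ractE HH h (f : 'Hom(H ⊗ H, k^o)) a b :
  (ract (f : Kbimod HH) h : 'Hom(H ⊗ H, k^o)) (tens a b) =
    tlift (fun h1 h2 => f (tens a (h2 * b * antipodeV HH h1))) (comul HH h).
Proof.
have [bl br] := @tens_bilinear k H H.
rewrite tlinfunE //; split=> [y c x x'|x c y y']; rewrite -tliftP;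
  apply: eq_tlift => h1 h2; first by rewrite bl linearP.
by rewrite mulrDr -scalerAr mulrDl -scalerAl br linearP.
Qed.

Section ModularInvariance.
Variables (HH : hopf_algebra) (rb : ribbon HH).
Local Notation K := (Kbimod HH).

Definition mono_act (X : bimod) (f : K) (x : X) : X :=
  tlift (fun qb1 qb2 => tlift (fun q1 q2 =>
      (f (tens qb1 q1) : k) *: ract (lact qb2 x) q2)
    (monodromy rb)) (monodromyV rb).

Definition partial_mono_trace (X Y : bimod) (g : 'Hom(X, Y ⊗ X)) : 'Hom(K, Y) :=
  linfun (fun f : K => \sum_(i < \dim (@fullv k X))
    tlift (fun (y : Y) (x : X) =>
        coord (vbasis fullv) i (ract (lact (rt rb) x) (rt rb)) *: y)
      (g (mono_act f (vbasis fullv)`_i))).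

Definition SK (lam : 'Hom(H, k^o)) : 'End(K) :=
  linfun (fun f : K => (tlinfun (fun a b =>
    tlift (fun qb1 qb2 => tlift (fun q1 q2 =>
        f (tens qb1 q1) * lam (antipode HH qb2 * a) * lam (b * antipodeV HH q2))
      (monodromy rb)) (monodromyV rb)) : K)).

Definition TK : 'End(K) :=
  linfun (fun f : K =>
    (tlinfun (fun a b => f (tens (rv rb * a) (b * (rv rb)^-1))) : K)).

Lemma mono_actP (X : bimod) a (f f' : K) (x : X) :
  mono_act (a *: f + f') x = a *: mono_act f x + mono_act f' x.
Proof.
rewrite /mono_act -tliftP; apply: eq_tlift => qb1 qb2.
rewrite -tliftP; apply: eq_tlift => q1 q2.
by rewrite add_lfunE scale_lfunE scalerDl scalerA.
Qed.

Lemma partial_mono_traceE (X Y : bimod) (g : 'Hom(X, Y ⊗ X)) (f : K) :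
  partial_mono_trace g f = \sum_(i < \dim (@fullv k X))
    tlift (fun (y : Y) (x : X) =>
        coord (vbasis fullv) i (ract (lact (rt rb) x) (rt rb)) *: y)
      (g (mono_act f (vbasis fullv)`_i)).
Proof.
rewrite /partial_mono_trace.
set F := (fun f : K => _).
have linF : linear F.
  move=> a f1 f2; rewrite /F scaler_sumr -big_split; apply: eq_bigr => i _ /=.
  by rewrite mono_actP !linearP.
pose L := GRing.isSemilinear.Build k K Y _ F (GRing.semilinear_linear linF).
pose G : {linear K -> Y} := HB.pack F L.
by rewrite -[F]/(G : _ -> _) lfunE.
Qed.

Lemma SKE (lam : 'Hom(H, k^o)) (f : K) (a b : H) :
  SK lam f (tens a b) =
    tlift (fun qb1 qb2 => tlift (fun q1 q2 =>
        f (tens qb1 q1) * lam (antipode HH qb2 * a) * lam (b * antipodeV HH q2))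
      (monodromy rb)) (monodromyV rb).
Proof.
rewrite /SK.
set F := (fun f : K => _).
have linF : linear F.
  move=> c f1 f2; apply/lfunP => z.
  rewrite add_lfunE scale_lfunE !lfunE /= -tliftP; apply: eq_tlift => x y.
  rewrite -tliftP; apply: eq_tlift => ? ?; rewrite -tliftP; apply: eq_tlift => ? ?.
  by rewrite add_lfunE scale_lfunE !mulrDl !scalerAl.
pose L := GRing.isSemilinear.Build k K K _ F (GRing.semilinear_linear linF).
pose G : {linear K -> K} := HB.pack F L.
rewrite -[F]/(G : _ -> _) lfunE /= /F tlinfunE //.
split=> [y c x x'|x c y y']; rewrite -tliftP; apply: eq_tlift => ? ?;
  rewrite -tliftP; apply: eq_tlift => ? ?.
  by rewrite mulrDr -scalerAr linearP /= mulrDr mulrDl -scalerAr -scalerAl.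
by rewrite [(c *: y + y') * _]mulrDl -[(c *: y) * _]scalerAl linearP /= mulrDr -scalerAr.
Qed.

Lemma TKE (f : K) (a b : H) :
  TK f (tens a b) = f (tens (rv rb * a) (b * (rv rb)^-1)).
Proof.
have [bl br] := @tens_bilinear k H H.
rewrite /TK.
set F := (fun f : K => _).
have linF : linear F.
  move=> c f1 f2; apply/lfunP => z.
  rewrite add_lfunE scale_lfunE !lfunE /= -tliftP; apply: eq_tlift => x y.
  by rewrite add_lfunE scale_lfunE.
pose L := GRing.isSemilinear.Build k K K _ F (GRing.semilinear_linear linF).
pose G : {linear K -> K} := HB.pack F L.
rewrite -[F]/(G : _ -> _) lfunE /= /F tlinfunE //.
split=> [y c x x'|x c y y'].
  by rewrite mulrDr -scalerAr bl linearP.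
by rewrite mulrDl -scalerAl br linearP.
Qed.

(* Invariance under the generators S, T, D of Γ_{1;1}. *)
Definition Gamma11_invariant (lam : 'Hom(H, k^o)) (X : bimod)
    (g : 'Hom(K, X)) : Prop :=
  [/\ (g \o (SK lam)^-1)%VF = g, (g \o TK^-1)%VF = g
    & forall f : K, twist rb (g f) = g f].

Definition modular_invariant (lam : 'Hom(H, k^o)) (A : bimod)
    (Delta : 'Hom(A, A ⊗ A)) : Prop :=
  is_bimod_hom (partial_mono_trace Delta) /\
  Gamma11_invariant lam (partial_mono_trace Delta).

End ModularInvariance.

End Hopf.

(* Main.v *)
(** The normalised integral and cointegral give dual bases
    [x = Σ λ(s(Λ_2) x) Λ_1] of [H].  They make the antipode invertible and
    anti-multiplicative, give [λ(xy) = λ(s^2(y)x)], and yield the Frobenius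
    axioms; since [λ(1) = ε(Λ)], specialness is Maschke's criterion.  Symmetry
    is [Λ_2 ⊗ Λ_1 = s(t) Λ_1 s^-1(t) ⊗ Λ_2], obtained by conjugating [Δ(Λ)]
    with [R].

    For modular invariance, write [Q = q_1 ⊗ q_2] and [Q^-1 = qb_1 ⊗ qb_2].
    Evaluating the trace in the dual bases gives
      [t_Q(Δ_F)(f)(y) = f(qb_1 ⊗ q_1) λ(s(y_1) s(qb_2) y_2 s^-1(ω(q_2)))].
    The quantum Fourier transforms [e ↦ λ(q_1 e) q_2] and [e ↦ λ(qb_1 e) qb_2]
    are inverse to each other up to the antipode, so for [y = s(h)] the right
    hand side equals [f(s(h_1) Λ_1 h_2 ⊗ ω^-1(s(Λ_2)))].  Invariance under [S]
    and [T] thus becomes invariance of [Λ_1 ⊗ s(Λ_2)] under the Fourier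
    transforms and under [v ⊗ v^-1]. *)

Require Import Defs.
From HB Require Import structures.
From mathcomp Require Import all_boot all_order all_algebra all_field.

Set Implicit Arguments.
Unset Strict Implicit.
Unset Printing Implicit Defensive.

Import GRing.Theory.
Local Open Scope ring_scope.

(** * Multilinear Sweedler calculus *)

(* Sweedler notation: with [z := Δ h] this reads [Σ F h_1 h_2].  All rewriting
   rules below need [F] to be multilinear; [lin_tac] proves these conditions. *)
Notation "'\ten_(' a , b <- z ) F" := (tlift (fun a b => F) z)
  (at level 41, a name, b name, z at level 50, F at level 41,
   format "'[' \ten_( a ,  b  <-  z )  '/  '  F ']'").

(** A tensor is here a coordinate matrix and not a formal sum, so an identity of tensors is stated
    for an arbitrary multilinear [F] under [tlift] and then used by rewriting. Only the two axioms
    of the antipode are given, and [antipodeV] is a mere linear inverse, meaningful once [s] is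
    known to be injective. The starting point is therefore the passage of elements across the two
    legs of Δ(Λ): it needs the axioms alone and recovers [x] explicitly from [s x]. The Fourier
    transforms are invertible because of the normalisation λ(q_1) q_2 = Λ. Applying Δ to it and
    using the hexagon writes Δ(Λ) through Q and two copies of R, and these copies are exactly what
    Q^-1 contributes. In the partial trace the element t is what exchanges the two legs of Δ(Λ),
    after which the dual bases collapse. A ribbon automorphism preserves R and v, hence also λ, so
    it commutes with the Fourier transforms; the formula for general ω is the one for the identity
    with the second argument of [f] transported by ω^-1. *)

Section TensorCalculus.
Variable k : fieldType.
Implicit Types U V W : vectType k.

(** A name for [linear], so that [lin_step] can match on the goal [lin f] and on the body of [f]. *)
Definition lin U V (f : U -> V) := linear f.

Lemma linE U V (f : U -> V) : lin f -> forall a x y, f (a *: x + y) = a *: f x + f y.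
Proof. by []. Qed.

Lemma bilin_lin U V W (f : U -> V -> W) :
  (forall y, lin (fun x => f x y)) -> (forall x, lin (f x)) -> bilinear_map f.
Proof. by move=> fl fr; split=> [y a x x'|x a y y']; [apply: (fl y)|apply: (fr x)]. Qed.

Lemma lin_id U : lin (fun x : U => x). Proof. by []. Qed.

Lemma lin_hom U V W (g : 'Hom(V, W)) (f : U -> V) : lin f -> lin (fun x => g (f x)).
Proof. by move=> lf a x y; rewrite lf linearP. Qed.

Lemma lin_comp U V W (g : V -> W) (f : U -> V) : lin g -> lin f -> lin (fun x => g (f x)).
Proof. by move=> lg lf a x y; rewrite lf lg. Qed.

Lemma lin_app U V W (f : U -> 'Hom(V, W)) v : lin f -> lin (fun x => f x v).
Proof. by move=> lf a x y; rewrite lf add_lfunE scale_lfunE. Qed.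

Lemma lin_scaler U V (c : k) (f : U -> V) : lin f -> lin (fun x => c *: f x).
Proof. by move=> lf a x y; rewrite lf scalerDr !scalerA mulrC. Qed.

Lemma lin_scalel U V (f : U -> k^o) (v : V) : lin f -> lin (fun x => (f x : k) *: v).
Proof. by move=> lf a x y; rewrite lf scalerDl scalerA. Qed.

Lemma lin_mull U (A : falgType k) (f : U -> A) (c : A) : lin f -> lin (fun x => f x * c).
Proof. by move=> lf a x y; rewrite lf mulrDl scalerAl. Qed.

Lemma lin_mulr U (A : falgType k) (f : U -> A) (c : A) : lin f -> lin (fun x => c * f x).
Proof. by move=> lf a x y; rewrite lf mulrDr scalerAr. Qed.

Lemma lin_kmull U (f : U -> k^o) (c : k^o) : lin f -> lin (fun x => f x * c : k^o).
Proof. by move=> lf a x y; rewrite lf mulrDl scalerAl. Qed.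

Lemma lin_kmulr U (f : U -> k^o) (c : k^o) : lin f -> lin (fun x => c * f x : k^o).
Proof. by move=> lf a x y; rewrite lf mulrDr scalerAr. Qed.

Lemma lin_tensl U V W (f : U -> V) (c : W) : lin f -> lin (fun x => tens (f x) c).
Proof. by move=> lf a x y; rewrite lf; have [-> _] := @tens_bilinear k V W. Qed.

Lemma lin_tensr U V W (f : U -> V) (c : W) : lin f -> lin (fun x => tens c (f x)).
Proof. by move=> lf a x y; rewrite lf; have [_ ->] := @tens_bilinear k W V. Qed.

Lemma lin_tliftf U V1 V2 W (F : U -> V1 -> V2 -> W) z :
  (forall a b, lin (fun x => F x a b)) -> lin (fun x => tlift (F x) z).
Proof. by move=> lF a x y; rewrite -tliftP; apply: eq_tlift => u v; apply: lF. Qed.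

Lemma lin_tliftz U V1 V2 W (F : V1 -> V2 -> W) (z : U -> V1 ⊗ V2) :
  lin z -> lin (fun x => tlift F (z x)).
Proof. by move=> lz a x y; rewrite lz linearP. Qed.

Lemma linfunE U V (f : U -> V) x : lin f -> linfun f x = f x.
Proof.
move=> lf; pose S := GRing.isSemilinear.Build k U V _ f (GRing.semilinear_linear lf).
pose G : {linear U -> V} := HB.pack f S.
by rewrite -[f]/(G : _ -> _) lfunE.
Qed.

Lemma linD U V (f : U -> V) : lin f -> forall x y, f (x + y) = f x + f y.
Proof. by move=> lf x y; have:= lf 1 x y; rewrite !scale1r. Qed.

Lemma lin0 U V (f : U -> V) : lin f -> f 0 = 0.
Proof. by move=> lf; apply: (addrI (f 0)); rewrite -linD // !addr0. Qed.

Lemma linZ U V (f : U -> V) : lin f -> forall a x, f (a *: x) = a *: f x.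
Proof. by move=> lf a x; have:= lf a x 0; rewrite (lin0 lf) !addr0. Qed.

Lemma lin_sum U V (f : U -> V) I (r : seq I) (P : pred I) (F : I -> U) :
  lin f -> f (\sum_(i <- r | P i) F i) = \sum_(i <- r | P i) f (F i).
Proof. by move=> lf; apply: big_morph => [x y|]; [apply: linD|apply: lin0]. Qed.

(** [g] is injective, hence bijective by finite dimension, so its left inverse is two-sided. *)
Lemma lin_cancel U (f g : U -> U) : lin f -> lin g -> cancel g f -> cancel f g.
Proof.
move=> lf lg gK x; have gE y : linfun g y = g y by rewrite linfunE.
have g0 : lker (linfun g) == 0%VS by apply/lker0P => a b; rewrite !gE; apply: can_inj gK a b.
by rewrite -{1}(lker0_lfunVK g0 x) gE gK -gE lker0_lfunVK.
Qed.

Lemma lin_tlift U V W W' (g : W -> W') (f : U -> V -> W) z :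
  lin g -> g (tlift f z) = \ten_(a, b <- z) g (f a b).
Proof.
move=> lg; rewrite /tlift lin_sum //; apply: eq_bigr => i _; rewrite lin_sum //.
by apply: eq_bigr => j _; rewrite linZ.
Qed.

(** Both sides are one finite sum over four basis indices, so the rule holds for arbitrary [F]. *)
Lemma ten_exch U V U' V' W (F : U -> V -> U' -> V' -> W) z z' :
  \ten_(a, b <- z) (\ten_(c, d <- z') F a b c d) =
  \ten_(c, d <- z') (\ten_(a, b <- z) F a b c d).
Proof.
rewrite [LHS](_ : _ = \sum_i \sum_j \sum_i' \sum_j' z i j *: (z' i' j' *:
    F (vbasis fullv)`_i (vbasis fullv)`_j (vbasis fullv)`_i' (vbasis fullv)`_j')); last first.
  apply: eq_bigr => i _; apply: eq_bigr => j _; rewrite scaler_sumr.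
  by apply: eq_bigr => i' _; rewrite scaler_sumr.
rewrite [RHS](_ : _ = \sum_i' \sum_j' \sum_i \sum_j z i j *: (z' i' j' *:
    F (vbasis fullv)`_i (vbasis fullv)`_j (vbasis fullv)`_i' (vbasis fullv)`_j')); last first.
  apply: eq_bigr => i _; apply: eq_bigr => j _; rewrite scaler_sumr.
  apply: eq_bigr => i' _; rewrite scaler_sumr; apply: eq_bigr => j' _.
  by rewrite !scalerA mulrC.
under eq_bigr => i _ do rewrite exchange_big /=.
rewrite exchange_big /=; apply: eq_bigr => i' _.
under eq_bigr => i _ do rewrite exchange_big /=.
by rewrite exchange_big.
Qed.

Lemma ten_flip U V W (F : V -> U -> W) (z : U ⊗ V) :
  bilinear_map F -> tlift F (tflip z) = \ten_(a, b <- z) F b a.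
Proof.
move=> bF; rewrite /tflip (lin_tlift (g := tlift F)); last exact: linearP.
by apply: eq_tlift => a b; rewrite tlift_tens.
Qed.

Lemma ten_map U V U' V' W (F : U' -> V' -> W) (g : U -> U') (h : V -> V') z :
  bilinear_map F -> tlift F (tmap g h z) = \ten_(a, b <- z) F (g a) (h b).
Proof.
move=> bF; rewrite /tmap (lin_tlift (g := tlift F)); last exact: linearP.
by apply: eq_tlift => a b; rewrite tlift_tens.
Qed.

Lemma ten_id U V (z : U ⊗ V) : \ten_(a, b <- z) tens a b = z.
Proof.
apply: (tensor_ind (P := fun z => \ten_(a, b <- z) tens a b = z)) => [|x y Hx Hy|x y].
- by rewrite linear0.
- by rewrite linearD /= Hx Hy.
- by rewrite tlift_tens //; apply: tens_bilinear.
Qed.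

End TensorCalculus.

Definition trilin (k : fieldType) (U V W X : vectType k) (F : U -> V -> W -> X) :=
  [/\ forall b c, lin (fun a => F a b c), forall a c, lin (fun b => F a b c)
    & forall a b, lin (F a b)].

Lemma trilin_lin (k : fieldType) (U V W X : vectType k) (F : U -> V -> W -> X) :
  (forall b c, lin (fun a => F a b c)) -> (forall a c, lin (fun b => F a b c)) ->
  (forall a b, lin (fun c => F a b c)) -> trilin F.
Proof. by []. Qed.

(** One rule for each shape of the body. Linearity of a variable function is looked up among the
    hypotheses, which is why proofs first split [bilinear_map] and [trilin] into their
    components. *)
Ltac lin_step :=
  match goal with
  | |- bilinear_map _ => apply: bilin_lin
  | |- trilin _ => apply: trilin_lin
  | H : _ |- lin _ => solve [apply: H]
  | |- _ /\ _ => split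
  | |- forall _, _ => let x := fresh "x" in intro x
  | |- lin (tlift _) => exact: linearP
  | |- lin (fun_of_lfun _) => exact: linearP
  | |- lin ?f => let f' := eval cbn beta in f in
     match f' with
     | (fun x => x) => apply: lin_id
     | (fun x => tlift (@?F x) ?z) => apply: (@lin_tliftf _ _ _ _ _ F z)
     | (fun x => tlift ?F (@?z x)) => apply: (@lin_tliftz _ _ _ _ _ F z)
     | (fun x => tens (@?g x) ?c) => apply: (@lin_tensl _ _ _ _ g c)
     | (fun x => tens ?c (@?g x)) => apply: (@lin_tensr _ _ _ _ g c)
     | (fun x => ?c *: (@?g x)) => apply: (@lin_scaler _ _ _ c g)
     | (fun x => (@?g x) *: ?c) => apply: (@lin_scalel _ _ _ g c)
     | (fun x => (@?g x) * ?c) => first [apply: (@lin_kmull _ _ g c)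
                                   | apply: (@lin_mull _ _ _ g c)]
     | (fun x => ?c * (@?g x)) => first [apply: (@lin_kmulr _ _ g c)
                                   | apply: (@lin_mulr _ _ _ g c)]
     | (fun x => fun_of_lfun ?h (@?g x)) => apply: (@lin_hom _ _ _ _ h g)
     | (fun x => fun_of_lfun (@?g x) ?c) => apply: (@lin_app _ _ _ _ g c)
     | (fun x => ?F (@?g x) ?a) => apply: (@lin_comp _ _ _ _ (fun y => F y a) g)
     | (fun x => ?F (@?g x) ?a ?b) => apply: (@lin_comp _ _ _ _ (fun y => F y a b) g)
     | (fun x => ?F ?a (@?g x) ?b) => apply: (@lin_comp _ _ _ _ (fun y => F a y b) g)
     | (fun x => ?F (@?g x)) => apply: (@lin_comp _ _ _ _ F g)
     end
  end.
Ltac lin_tac := solve [repeat first [assumption | lin_step | progress cbv beta]].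

(** * Hopf algebras and R-matrices *)

Section HopfBasics.
Variables (k : fieldType) (H : falgType k) (HH : hopf_algebra H).
Local Notation Δ := (comul HH).
Local Notation ε := (counit HH).
Local Notation s := (antipode HH).
Implicit Types (W : vectType k) (x y h : H).

Lemma ten_assoc (A B C : vectType k) W (F : A -> B -> C -> W) z : trilin F ->
  tlift (fun a w => tlift (F a) w) (tassoc z) = \ten_(w, c <- z) (\ten_(a, b <- w) F a b c).
Proof.
case=> F1 F2 F3; rewrite /tassoc (lin_tlift (g := tlift _)); last exact: linearP.
apply: eq_tlift => w c; rewrite (lin_tlift (g := tlift _)); last exact: linearP.
by apply: eq_tlift => a b; rewrite tlift_tens ?tlift_tens //; lin_tac.
Qed.

Lemma comulA W (F : H -> H -> H -> W) h : trilin F ->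
  \ten_(a, b <- Δ h) (\ten_(c, d <- Δ a) F c d b) =
  \ten_(a, b <- Δ h) (\ten_(c, d <- Δ b) F a c d).
Proof.
move=> tF; have [F1 F2 F3] := tF.
have [/(_ h) E _ _] := comul_coalgebra HH.
have := congr1 (tlift (fun a w => tlift (F a) w)) E.
rewrite ten_assoc // ten_map; last lin_tac.
by rewrite ten_map //; lin_tac.
Qed.

Lemma counit_l W (g : H -> W) h : lin g -> \ten_(a, b <- Δ h) (ε a : k) *: g b = g h.
Proof.
move=> lg; have [_ /(_ h) E _] := comul_coalgebra HH.
have := congr1 (tlift (fun (a : k^o) b => (a : k) *: g b)) E.
by rewrite ten_map ?tlift_tens ?scale1r //; lin_tac.
Qed.

Lemma counit_r W (g : H -> W) h : lin g -> \ten_(a, b <- Δ h) (ε b : k) *: g a = g h.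
Proof.
move=> lg; have [_ _ /(_ h) E] := comul_coalgebra HH.
have := congr1 (tlift (fun a (b : k^o) => (b : k) *: g a)) E.
by rewrite ten_map ?tlift_tens ?scale1r //; lin_tac.
Qed.

Lemma ten_mul W (F : H -> H -> W) z w : bilinear_map F ->
  tlift F (tmul z w) = \ten_(a, b <- z) (\ten_(c, d <- w) F (a * c) (b * d)).
Proof.
move=> bF; rewrite /tmul (lin_tlift (g := tlift _)); last exact: linearP.
apply: eq_tlift => a b; rewrite (lin_tlift (g := tlift _)); last exact: linearP.
by apply: eq_tlift => c d; rewrite tlift_tens.
Qed.

Lemma ten_comulM W (F : H -> H -> W) x y : bilinear_map F ->
  tlift F (Δ (x * y)) = \ten_(a, b <- Δ x) (\ten_(c, d <- Δ y) F (a * c) (b * d)).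
Proof. by move=> bF; rewrite comulM ten_mul. Qed.

Lemma ten_comul1 W (F : H -> H -> W) : bilinear_map F -> tlift F (Δ 1) = F 1 1.
Proof. by move=> bF; rewrite comul1 tlift_tens. Qed.

Lemma ten_antipodel W (g : H -> W) h : lin g ->
  \ten_(a, b <- Δ h) g (s a * b) = (ε h : k) *: g 1.
Proof. by move=> lg; rewrite -(lin_tlift (g := g)) // antipodel linZ. Qed.

Lemma ten_antipoder W (g : H -> W) h : lin g ->
  \ten_(a, b <- Δ h) g (a * s b) = (ε h : k) *: g 1.
Proof. by move=> lg; rewrite -(lin_tlift (g := g)) // antipoder linZ. Qed.

End HopfBasics.

Arguments comulA {k H} HH {W} F h.
Arguments counit_l {k H} HH {W} g h.
Arguments counit_r {k H} HH {W} g h.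
Arguments ten_comulM {k H} HH {W} F x y.
Arguments ten_comul1 {k H} HH {W} F.
Arguments ten_antipodel {k H} HH {W} g h.
Arguments ten_antipoder {k H} HH {W} g h.

Section TensorAlgebra.
Variables (k : fieldType) (H : falgType k).
Implicit Types (W : vectType k) (z w : H ⊗ H).

Lemma tmulE z w : tmul z w = \ten_(a, b <- z) \ten_(c, d <- w) tens (a * c) (b * d).
Proof. by []. Qed.

Lemma tmul_tens (a b c d : H) : tmul (tens a b) (tens c d) = tens (a * c) (b * d).
Proof. by rewrite /tmul !tlift_tens //; lin_tac. Qed.

Lemma tmulA z1 z2 z3 : tmul z1 (tmul z2 z3) = tmul (tmul z1 z2) z3.
Proof.
rewrite [RHS]tmulE ten_mul; last lin_tac.
rewrite /tmul; apply: eq_tlift => a b.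
rewrite (lin_tlift (g := tlift _)); last lin_tac.
apply: eq_tlift => c d; rewrite (lin_tlift (g := tlift _)); last lin_tac.
by apply: eq_tlift => e f; rewrite tlift_tens ?mulrA //; lin_tac.
Qed.

Lemma tmul1z z : tmul (tens 1 1) z = z.
Proof.
rewrite /tmul tlift_tens; last lin_tac.
by rewrite -[RHS]ten_id; apply: eq_tlift => a b; rewrite !mul1r.
Qed.

Lemma tmulz1 z : tmul z (tens 1 1) = z.
Proof.
rewrite /tmul -[RHS]ten_id; apply: eq_tlift => a b.
by rewrite tlift_tens ?mulr1 //; lin_tac.
Qed.

Lemma tflip_mul z w : tflip (tmul z w) = tmul (tflip z) (tflip w).
Proof.
rewrite {1}/tflip ten_mul; last lin_tac.
rewrite /tmul ten_flip; last lin_tac.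
by apply: eq_tlift => a b; rewrite ten_flip //; lin_tac.
Qed.

Lemma tflipK (U V : vectType k) (z : U ⊗ V) : tflip (tflip z) = z.
Proof. by rewrite {1}/tflip ten_flip ?ten_id //; lin_tac. Qed.

End TensorAlgebra.

(** * R-matrix, its inverse and the monodromy *)

Section RMatrix.
Variables (k : fieldType) (H : falgType k) (HH : hopf_algebra H).
Local Notation Δ := (comul HH).
Local Notation ε := (counit HH).
Local Notation s := (antipode HH).
Local Notation sV := (antipodeV HH).
Implicit Types (W : vectType k) (x y h : H).
Variable qt : quasitriangular HH.
Local Notation R := (Rmx qt).
Local Notation Rb := (Rinv qt).
Local Notation Q := (monodromy qt).
Local Notation Qb := (monodromyV qt).

Lemma tmulRbR z : tmul Rb (tmul R z) = z. Proof. by rewrite tmulA RmxK tmul1z. Qed.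

Lemma Rmx_comul h : tmul R (Δ h) = tmul (tflip (Δ h)) R.
Proof. by rewrite (Rmx_op qt) -!tmulA RmxK tmulz1. Qed.

Lemma Rinv_uniq z : tmul z R = tens 1 1 -> z = Rb.
Proof. by move=> E; rewrite -[LHS]tmulz1 -(RmxV qt) tmulA E tmul1z. Qed.

Lemma monodromyVK : tmul Qb Q = tens 1 1.
Proof.
rewrite /monodromy /monodromyV -tmulA [X in tmul _ X]tmulA -tflip_mul RmxK.
by rewrite /tflip tlift_tens ?tmul1z ?RmxK //; lin_tac.
Qed.

Lemma monodromyKV : tmul Q Qb = tens 1 1.
Proof.
rewrite /monodromy /monodromyV -tmulA [X in tmul _ X]tmulA RmxV tmul1z -tflip_mul RmxV.
by rewrite /tflip tlift_tens //; lin_tac.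
Qed.

Lemma monodromy_comul h : tmul Q (Δ h) = tmul (Δ h) Q.
Proof.
have E : tmul (tflip R) (tflip (Δ h)) = tmul (Δ h) (tflip R).
  by rewrite -tflip_mul Rmx_comul tflip_mul tflipK.
by rewrite /monodromy -tmulA Rmx_comul tmulA E tmulA.
Qed.

Lemma monodromyV_comul h : tmul Qb (Δ h) = tmul (Δ h) Qb.
Proof.
transitivity (tmul Qb (tmul (tmul (Δ h) Q) Qb)).
  by rewrite -[tmul (tmul (Δ h) Q) Qb]tmulA monodromyKV tmulz1.
by rewrite -monodromy_comul (tmulA Qb _ Qb) (tmulA Qb Q) monodromyVK tmul1z.
Qed.

Lemma ten_Rmx_comull W (F : H -> H -> H -> W) : trilin F ->
  \ten_(r, t <- R) \ten_(a, b <- Δ r) F a b t =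
  \ten_(r, t <- R) \ten_(r', t' <- R) F r r' (t * t').
Proof.
move=> tF; have [F1 F2 F3] := tF.
have := congr1 (tlift (fun w t => \ten_(a, b <- w) F a b t)) (Rmx_comull qt).
rewrite ten_map; last lin_tac.
move=> ->; rewrite (lin_tlift (g := tlift _)); last lin_tac.
apply: eq_tlift => r t; rewrite (lin_tlift (g := tlift _)); last lin_tac.
by apply: eq_tlift => r' t'; rewrite !tlift_tens //; lin_tac.
Qed.

Lemma ten_Rmx_comulr W (F : H -> H -> H -> W) : trilin F ->
  \ten_(r, t <- R) \ten_(a, b <- Δ t) F r a b =
  \ten_(r, t <- R) \ten_(r', t' <- R) F (r * r') t' t.
Proof.
move=> tF; have [F1 F2 F3] := tF.
have := congr1 (tlift (fun r w => \ten_(a, b <- w) F r a b)) (Rmx_comulr qt).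
rewrite ten_map; last lin_tac.
move=> ->; rewrite (lin_tlift (g := tlift _)); last lin_tac.
apply: eq_tlift => r t; rewrite (lin_tlift (g := tlift _)); last lin_tac.
by apply: eq_tlift => r' t'; rewrite !tlift_tens //; lin_tac.
Qed.

(** Applying ε to the first leg of (Δ ⊗ id)(R) = R_13 R_23 gives R = (1 ⊗ e) R for e = ε(r) t, and R
    can be cancelled. *)
Lemma counit_Rmx W (g : H -> W) : lin g -> \ten_(r, t <- R) (ε r : k) *: g t = g 1.
Proof.
move=> lg; pose e := \ten_(r, t <- R) (ε r : k) *: t.
transitivity (g e).
  by rewrite (lin_tlift (g := g)) //; apply: eq_tlift => r t; rewrite linZ.
suff E : tens (1 : H) e = tens 1 1.
  have := congr1 (tlift (fun a b => (ε a : k) *: g b)) E.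
  by rewrite !tlift_tens ?counit1 ?scale1r //; lin_tac.
rewrite -[LHS]tmulz1 -(RmxV qt) tmulA [tmul _ R](_ : _ = R) ?RmxV //.
rewrite -[RHS]ten_id /tmul tlift_tens; last lin_tac.
transitivity (\ten_(r, t <- R) \ten_(a, b <- Δ r) (ε a : k) *: tens b t).
  rewrite (ten_Rmx_comull (F := fun a b t => (ε a : k) *: tens b t)); last lin_tac.
  rewrite ten_exch; apply: eq_tlift => a b; rewrite /e.
  rewrite (lin_tlift (g := fun e => tens (1 * a) (e * b))); last lin_tac.
  apply: eq_tlift => r t; rewrite mul1r -scalerAl.
  by rewrite (linZ (f := fun t => tens a t)) //; lin_tac.
apply: eq_tlift => r t.
by rewrite (counit_l HH (fun b => tens b t)) //; lin_tac.
Qed.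

Lemma Rmx_counit W (g : H -> W) : lin g -> \ten_(r, t <- R) (ε t : k) *: g r = g 1.
Proof.
move=> lg; pose e := \ten_(r, t <- R) (ε t : k) *: r.
transitivity (g e).
  by rewrite (lin_tlift (g := g)) //; apply: eq_tlift => r t; rewrite linZ.
suff E : tens e (1 : H) = tens 1 1.
  have := congr1 (tlift (fun a b => (ε b : k) *: g a)) E.
  by rewrite !tlift_tens ?counit1 ?scale1r //; lin_tac.
rewrite -[LHS]tmul1z -(RmxK qt) -tmulA [tmul R (tens _ _)](_ : _ = R) ?RmxK //.
rewrite -[RHS]ten_id /tmul.
transitivity (\ten_(r, t <- R) \ten_(a, b <- Δ t) (ε a : k) *: tens r b).
  rewrite (ten_Rmx_comulr (F := fun r a b => (ε a : k) *: tens r b)); last lin_tac.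
  apply: eq_tlift => a b; rewrite tlift_tens /e; last lin_tac.
  rewrite (lin_tlift (g := fun e => tens (a * e) (b * 1))); last lin_tac.
  apply: eq_tlift => r t; rewrite mulr1 -scalerAr.
  by rewrite (linZ (f := fun t => tens t b)) //; lin_tac.
apply: eq_tlift => r t.
by rewrite (counit_l HH (fun b => tens r b)) //; lin_tac.
Qed.

(** By (Δ ⊗ id)(R) = R_13 R_23 the product of (s ⊗ id)(R) with R has s(r_1) r_2 in its first leg,
    which the antipode axiom contracts. *)
Lemma ten_Rinv W (F : H -> H -> W) : bilinear_map F ->
  tlift F Rb = \ten_(r, t <- R) F (s r) t.
Proof.
move=> bF; have [F1 F2] := bF; rewrite -(@Rinv_uniq (\ten_(r, t <- R) tens (s r) t)).
  rewrite (lin_tlift (g := tlift _)); last lin_tac.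
  by apply: eq_tlift => r t; rewrite tlift_tens.
rewrite /tmul (lin_tlift (g := tlift _)); last lin_tac.
transitivity (\ten_(r, t <- R) \ten_(a, b <- Δ r) tens (s a * b) t).
  rewrite (ten_Rmx_comull (F := fun a b t => tens (s a * b) t)); last lin_tac.
  by apply: eq_tlift => a b; rewrite tlift_tens //; lin_tac.
rewrite -(counit_Rmx (g := fun t => tens 1 t)); last lin_tac.
by apply: eq_tlift => r t; rewrite (ten_antipodel HH (fun z => tens z t)) //; lin_tac.
Qed.

End RMatrix.

Section IteratedCoassociativity.
Variables (k : fieldType) (H : falgType k) (HH : hopf_algebra H).
Local Notation Δ := (comul HH).
Implicit Types (W : vectType k).

Definition quadrilin (V : vectType k) W (F : V -> V -> V -> V -> W) :=
  (forall a, trilin (F a)) /\ (forall b c d, lin (fun a => F a b c d)).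

(** On the left the middle legs [b], [c] form one coproduct, to which an identity about Δ applies.
    On the right [a], [b] do, and in [comulA4r] it is [c], [d]: these are the pairs that the
    antipode contracts. *)
Lemma comulA4l W (F : H -> H -> H -> H -> W) h : quadrilin F ->
  \ten_(a, x <- Δ h) \ten_(y, d <- Δ x) \ten_(b, c <- Δ y) F a b c d =
  \ten_(x, d <- Δ h) \ten_(y, c <- Δ x) \ten_(a, b <- Δ y) F a b c d.
Proof.
case=> F1 F2.
have T1 a c d : lin (fun b => F a b c d) by case: (F1 a).
have T2 a b d : lin (fun c => F a b c d) by case: (F1 a).
have T3 a b c : lin (fun d => F a b c d) by case: (F1 a).
rewrite -(comulA HH (fun a y d => \ten_(b, c <- Δ y) F a b c d)); last lin_tac.
by apply: eq_tlift => x d; rewrite -(comulA HH (fun a b c => F a b c d)) //; lin_tac.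
Qed.

Lemma comulA4r W (F : H -> H -> H -> H -> W) h : quadrilin F ->
  \ten_(a, x <- Δ h) \ten_(y, d <- Δ x) \ten_(b, c <- Δ y) F a b c d =
  \ten_(a, x <- Δ h) \ten_(b, y <- Δ x) \ten_(c, d <- Δ y) F a b c d.
Proof. by case=> F1 F2; apply: eq_tlift => a x; rewrite (comulA HH (F a)). Qed.

End IteratedCoassociativity.

Arguments comulA4l {k H} HH {W} F h.
Arguments comulA4r {k H} HH {W} F h.

(** * Tensors of linear forms *)

Section Separation.
Variable k : fieldType.
Implicit Types U V W : vectType k.

Lemma lin_tens_eq U V W (f g : U ⊗ V -> W) z : lin f -> lin g ->
  (forall x y, f (tens x y) = g (tens x y)) -> f z = g z.
Proof.
move=> lf lg E; rewrite -(ten_id z) (lin_tlift (g := f)) // (lin_tlift (g := g)) //.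
exact: eq_tlift.
Qed.

Definition separating U I (phi : I -> U -> k^o) :=
  (forall i, lin (phi i)) /\ forall x, (forall i, phi i x = 0) -> x = 0.

Lemma separating_eq U I (phi : I -> U -> k^o) x y :
  separating phi -> (forall i, phi i x = phi i y) -> x = y.
Proof.
case=> l phi0 E; apply/eqP; rewrite -subr_eq0; apply/eqP/phi0 => i.
by rewrite -scaleN1r addrC l E scaleN1r addNr.
Qed.

(** One leg at a time: contracting the second leg with [psi j] gives zero because [phi] separates,
    then contracting the first with a coordinate form gives zero because [psi] separates. The
    coordinates of the result are the matrix entries of [z]. *)
Lemma separating_tens U V I J (phi : I -> U -> k^o) (psi : J -> V -> k^o) :
  separating phi -> separating psi ->
  separating (fun ij z => \ten_(a, b <- z) phi ij.1 a * psi ij.2 b).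
Proof.
move=> [l1 s1] [l2 s2]; split=> [[i j]|z E] /=; first lin_tac.
pose cU := fun i => coord (vbasis (@fullv k U)) i : U -> k^o.
pose cV := fun i => coord (vbasis (@fullv k V)) i : V -> k^o.
have lU i : lin (cU i) by move=> a x y; rewrite /cU linearP.
have lV i : lin (cV i) by move=> a x y; rewrite /cV linearP.
have E1 j : \ten_(a, b <- z) (psi j b : k) *: a = 0.
  apply: s1 => i; rewrite (lin_tlift (g := phi i)) // -[RHS](E (i, j)).
  by apply: eq_tlift => a b; rewrite linZ // /GRing.scale /= mulrC.
have E2 i : \ten_(a, b <- z) (cU i a : k) *: b = 0.
  apply: s2 => j; rewrite (lin_tlift (g := psi j)) //.
  rewrite -(lin0 (lU i)) -[in RHS](E1 j) (lin_tlift (g := cU i)) //.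
  by apply: eq_tlift => a b; rewrite !linZ // /GRing.scale /= mulrC.
apply/matrixP => i j; rewrite -[z in LHS]ten_id.
rewrite (lin_tlift (g := fun w : U ⊗ V => (w : 'M[k]_(_, _)) i j : k^o)); last first.
  by move=> a x y; rewrite !mxE.
rewrite !mxE -[0](lin0 (lV j)) -(E2 i) (lin_tlift (g := cV j)) //.
by apply: (@eq_tlift k U V k^o) => a b; rewrite mxE linZ.
Qed.

Lemma separating_dual U : separating (fun (x : U) (p : 'Hom(U, k^o)) => p x).
Proof.
split=> [x|p E]; first lin_tac.
by apply/lfunP => x; rewrite lfunE.
Qed.

Definition ev2 U (z : 'Hom(U, k^o) ⊗ 'Hom(U, k^o)) (y x : U) : k^o :=
  tlift (fun p q : 'Hom(U, k^o) => p y * q x) z.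

Lemma ev2_eq U (z w : 'Hom(U, k^o) ⊗ 'Hom(U, k^o)) :
  (forall y x, ev2 z y x = ev2 w y x) -> z = w.
Proof.
move=> E; apply: (separating_eq (separating_tens (@separating_dual U) (@separating_dual U))).
by case=> y x; apply: E.
Qed.

(** The inverse of [ev2] on bilinear forms, written in a dual basis. It produces Δ_F(p), which is
    prescribed only through its values at pairs of points. *)
Definition form_tens U (beta : U -> U -> k^o) : 'Hom(U, k^o) ⊗ 'Hom(U, k^o) :=
  \sum_(i < \dim (@fullv k U)) \sum_(j < \dim (@fullv k U))
    (beta (vbasis fullv)`_i (vbasis fullv)`_j : k) *:
    tens (linfun (coord (vbasis (@fullv k U)) i : U -> k^o))
         (linfun (coord (vbasis (@fullv k U)) j : U -> k^o)).

Lemma form_tensE U (beta : U -> U -> k^o) y x : bilinear_map beta ->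
  ev2 (form_tens beta) y x = beta y x.
Proof.
move=> bb; have [b1 b2] := bb; rewrite /ev2.
rewrite (lin_sum _ _ _ (f := tlift _)); last lin_tac.
rewrite [y in RHS](coord_vbasis (memvf y)) (lin_sum _ _ _ (f := fun y => beta y x)); last lin_tac.
apply: eq_bigr => i _; rewrite (lin_sum _ _ _ (f := tlift _)); last lin_tac.
rewrite (linZ (f := fun y => beta y x)); last lin_tac.
rewrite [x in RHS](coord_vbasis (memvf x)) (lin_sum _ _ _ (f := beta _)); last lin_tac.
rewrite scaler_sumr; apply: eq_bigr => j _.
rewrite linearZ /= tlift_tens; last lin_tac.
rewrite !linfunE; [|by move=> a u w; rewrite linearP..].
rewrite (linZ (f := beta _)); last lin_tac.
by rewrite /GRing.scale /= mulrC mulrA.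
Qed.

End Separation.

(** * Structure maps of F_ω *)

Section FrobeniusStructure.
Variables (k : fieldType) (H : falgType k) (HH : hopf_algebra H).
Local Notation Δ := (comul HH).
Local Notation ε := (counit HH).
Local Notation s := (antipode HH).
Local Notation sV := (antipodeV HH).
Implicit Types (W : vectType k) (x y h : H).
Variables (L : H) (lam : 'Hom(H, k^o)) (om : 'AEnd(H)).
Local Notation F := (Fomega HH om).
Implicit Types (p q : 'Hom(H, k^o)).

Definition mF : 'Hom(F ⊗ F, F) :=
  linfun (fun z : F ⊗ F => linfun (fun x : H => \ten_(a, b <- Δ x) ev2 z b a) : F).

Definition etaF : 'Hom(k^o, F) := linfun (fun c : k^o => (c : k) *: (ε : F)).

Definition epsF : 'Hom(F, k^o) := linfun (fun p : F => (p : 'Hom(H, k^o)) L).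

Definition DeltaF : 'Hom(F, F ⊗ F) :=
  linfun (fun p : F => form_tens (fun y x =>
    \ten_(a, b <- Δ x) (p : 'Hom(H, k^o)) a * lam (s b * y)) : F ⊗ F).

Lemma mFE (z : F ⊗ F) x : (mF z : 'Hom(H, k^o)) x = \ten_(a, b <- Δ x) ev2 z b a.
Proof.
have lE (w : F ⊗ F) y : (linfun (fun x : H => \ten_(a, b <- Δ x) ev2 w b a) : 'Hom(H, k^o)) y =
    \ten_(a, b <- Δ y) ev2 w b a.
  by rewrite linfunE //; lin_tac.
rewrite /mF linfunE ?lE // => c z1 z2; apply/lfunP => y.
rewrite add_lfunE scale_lfunE !lE -tliftP; apply: eq_tlift => a b.
by rewrite /ev2 linearP.
Qed.

Lemma etaFE (c : k^o) : etaF c = (c : k) *: (ε : F).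
Proof. by rewrite /etaF linfunE // => a x y; rewrite scalerDl scalerA. Qed.

Lemma epsFE p : epsF p = p L.
Proof. by rewrite /epsF linfunE // => a x y; rewrite add_lfunE scale_lfunE. Qed.

Lemma DeltaFE p y x : ev2 (DeltaF p) y x = \ten_(a, b <- Δ x) p a * lam (s b * y).
Proof.
have bE (r : 'Hom(H, k^o)) : bilinear_map (fun y x => \ten_(a, b <- Δ x) r a * lam (s b * y) : k^o).
  by lin_tac.
rewrite /DeltaF linfunE ?form_tensE // => c p1 p2; apply: ev2_eq => y1 x1.
rewrite form_tensE //; transitivity (c *: ev2 (form_tens (fun y x =>
    \ten_(a, b <- Δ x) p1 a * lam (s b * y) : k^o)) y1 x1 + ev2 (form_tens (fun y x =>
    \ten_(a, b <- Δ x) p2 a * lam (s b * y) : k^o)) y1 x1); last by rewrite /ev2 linearP.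
rewrite !form_tensE // -tliftP; apply: eq_tlift => a b.
by rewrite add_lfunE scale_lfunE mulrDl scalerAl.
Qed.

End FrobeniusStructure.

(** * Integrals and the antipode *)

Section HopfAlgebra.
Variables (k : fieldType) (H : falgType k) (HH : hopf_algebra H).
Local Notation Δ := (comul HH).
Local Notation ε := (counit HH).
Local Notation s := (antipode HH).
Implicit Types (W : vectType k) (x y h : H).
Variables (L : H) (lam : 'Hom(H, k^o)).
Hypothesis HL : is_integral HH L.
Hypothesis Hlam : is_right_cointegral HH lam.
Hypothesis lamL : lam L = 1.

Lemma integral_l h : h * L = (ε h : k) *: L. Proof. by have [_ /(_ h) []] := HL. Qed.
Lemma integral_r h : L * h = (ε h : k) *: L. Proof. by have [_ /(_ h) []] := HL. Qed.

Lemma cointegral W (g : H -> W) h : lin g ->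
  \ten_(a, b <- Δ h) (lam a : k) *: g b = (lam h : k) *: g 1.
Proof.
move=> lg; have [_ /(_ h) E] := Hlam; rewrite -(linZ lg) -E (lin_tlift (g := g)) //.
by apply: eq_tlift => a b; rewrite (linZ lg).
Qed.

(** Insert s(x_1) x_2 in front of the first leg; then x_2 Λ_1 ⊗ x_3 Λ_2 = Δ(x_2 Λ) = ε(x_2) Δ(Λ). *)
Lemma integral_mull W (F : H -> H -> W) x : bilinear_map F ->
  \ten_(a, b <- Δ L) F a (x * b) = \ten_(a, b <- Δ L) F (s x * a) b.
Proof.
move=> bF; have [F1 F2] := bF.
transitivity (\ten_(x1, x2 <- Δ x) \ten_(c, d <- Δ x2) \ten_(a, b <- Δ L)
    F (s x1 * (c * a)) (d * b)).
  rewrite -(comulA HH (fun x1 c d => \ten_(a, b <- Δ L) F (s x1 * (c * a)) (d * b)));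
    last lin_tac.
  rewrite -[LHS](counit_l HH (fun x => \ten_(a, b <- Δ L) F a (x * b)) x);
    last lin_tac.
  apply: eq_tlift => x1 x2.
  under [RHS]eq_tlift => c d do under eq_tlift => a b do rewrite mulrA.
  rewrite (ten_antipodel HH (fun z => \ten_(a, b <- Δ L) F (z * a) (x2 * b))); last lin_tac.
  by congr (_ *: _); apply: eq_tlift => a b; rewrite mul1r.
rewrite -[RHS](counit_r HH (fun x => \ten_(a, b <- Δ L) F (s x * a) b) x);
    last lin_tac.
apply: eq_tlift => x1 x2.
rewrite -(ten_comulM HH (fun a b => F (s x1 * a) b)); last lin_tac.
by rewrite integral_l !linearZ.
Qed.

Lemma integral_mulr W (F : H -> H -> W) x : bilinear_map F ->
  \ten_(a, b <- Δ L) F (a * x) b = \ten_(a, b <- Δ L) F a (b * s x).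
Proof.
move=> bF; have [F1 F2] := bF.
transitivity (\ten_(x1, x2 <- Δ x) \ten_(c, d <- Δ x1) \ten_(a, b <- Δ L)
    F (a * c) (b * d * s x2)).
  rewrite (comulA HH (fun c d x2 => \ten_(a, b <- Δ L) F (a * c) (b * d * s x2)));
    last lin_tac.
  rewrite -[LHS](counit_r HH (fun x => \ten_(a, b <- Δ L) F (a * x) b) x); last lin_tac.
  apply: eq_tlift => x1 x2.
  under [RHS]eq_tlift => c d do under eq_tlift => a b do rewrite -mulrA.
  rewrite (ten_antipoder HH (fun z => \ten_(a, b <- Δ L) F (a * x1) (b * z))); last lin_tac.
  by congr (_ *: _); apply: eq_tlift => a b; rewrite mulr1.
rewrite -[RHS](counit_l HH (fun x => \ten_(a, b <- Δ L) F a (b * s x)) x); last lin_tac.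
apply: eq_tlift => x1 x2; rewrite ten_exch.
rewrite -(ten_comulM HH (fun a b => F a (b * s x2))); last lin_tac.
by rewrite integral_r !linearZ.
Qed.

(** Insert y_2 s(y_3) behind the second leg and apply the cointegral property to x y_1. *)
Lemma cointegral_mul W (g : H -> W) x y : lin g ->
  \ten_(a, b <- Δ x) (lam (a * y) : k) *: g b =
  \ten_(a, b <- Δ y) (lam (x * a) : k) *: g (s b).
Proof.
move=> lg.
transitivity (\ten_(y1, y2 <- Δ y) \ten_(c, d <- Δ y1) \ten_(a, b <- Δ x)
    (lam (a * c) : k) *: g (b * d * s y2)).
  rewrite (comulA HH (fun c d y2 => \ten_(a, b <- Δ x) (lam (a * c) : k) *: g (b * d * s y2)));
    last lin_tac.
  rewrite -[LHS](counit_r HH (fun y => \ten_(a, b <- Δ x) (lam (a * y) : k) *: g b) y);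
    last lin_tac.
  apply: eq_tlift => y1 y2.
  under [RHS]eq_tlift => c d do under eq_tlift => a b do rewrite -mulrA.
  rewrite (ten_antipoder HH (fun z => \ten_(a, b <- Δ x) (lam (a * y1) : k) *: g (b * z)));
    last lin_tac.
  by congr (_ *: _); apply: eq_tlift => a b; rewrite mulr1.
apply: eq_tlift => y1 y2; rewrite ten_exch.
rewrite -(ten_comulM HH (fun a b => (lam a : k) *: g (b * s y2))); last lin_tac.
by rewrite (cointegral (g := fun z => g (z * s y2))) ?mul1r //; lin_tac.
Qed.

Local Notation sV := (antipodeV HH).

(** Recovers [x] from [s x] by means of the antipode axioms and the (co)integral alone; injectivity
    of the antipode is read off from it. *)
Lemma integral_antipode W (g : H -> W) x : lin g ->
  \ten_(a, b <- Δ L) (lam (s x * a) : k) *: g b = g x.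
Proof.
move=> lg; rewrite -(integral_mull (F := fun a b => (lam a : k) *: g b)); last lin_tac.
by rewrite (cointegral (g := fun b => g (x * b))) ?lamL ?scale1r ?mulr1 //; lin_tac.
Qed.

Lemma antipode_ker0 : lker s == 0%VS.
Proof.
apply/lker0P => x y E.
by rewrite -(integral_antipode (g := id) x) // E integral_antipode.
Qed.

Lemma antipodeK x : sV (s x) = x.
Proof. exact: lker0_lfunK antipode_ker0 x. Qed.

Lemma antipodeVK x : s (sV x) = x.
Proof. exact: lker0_lfunVK antipode_ker0 x. Qed.

Lemma antipode_inj : injective s. Proof. exact: can_inj antipodeK. Qed.

(** An element z is determined by λ(z Λ_1) Λ_2. For both products this equals λ(Λ_1) x y Λ_2, since
    [integral_mull] carries one factor after the other to the second leg. *)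
Lemma antipodeM x y : s (x * y) = s y * s x.
Proof.
suff E z t : \ten_(a, b <- Δ L) (lam (z * a) : k) *: b =
    \ten_(a, b <- Δ L) (lam (t * a) : k) *: b -> z = t.
  apply: E.
  rewrite -(integral_mull (F := fun a b => (lam a : k) *: b)); last lin_tac.
  under [RHS]eq_tlift => a b do rewrite -mulrA.
  rewrite -(integral_mull (F := fun a b => (lam (s y * a) : k) *: b)); last lin_tac.
  rewrite -(integral_mull (F := fun a b => (lam a : k) *: (x * b))); last lin_tac.
  by apply: eq_tlift => a b; rewrite mulrA.
rewrite -[z]antipodeVK -[t]antipodeVK.
by rewrite !(integral_antipode (g := id)) // => ->.
Qed.

Lemma antipode1 : s 1 = 1.
Proof.
have := antipodel HH 1; rewrite ten_comul1; last lin_tac.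
by rewrite counit1 scale1r mulr1.
Qed.

(** An explicit formula for the antipode, from which s(Λ) = Λ, ε(s(x)) = ε(x) and
    anti-comultiplicativity are computed. *)
Lemma integral_antipode_r W (g : H -> W) x : lin g ->
  \ten_(a, b <- Δ L) (lam (a * x) : k) *: g b = g (s x).
Proof.
move=> lg; rewrite cointegral_mul // -[RHS](counit_l HH (fun y => g (s y)) x); last lin_tac.
by apply: eq_tlift => a b; rewrite integral_r linearZ /= lamL /GRing.scale /= mulr1.
Qed.

Lemma antipode_integral : s L = L.
Proof.
rewrite -(integral_antipode_r (g := id)) // -[RHS](counit_l HH id) //.
by apply: eq_tlift => a b; rewrite integral_l linearZ /= lamL /GRing.scale /= mulr1.
Qed.

Lemma counit_antipode x : ε (s x) = ε x.
Proof.
rewrite -(integral_antipode_r (g := fun y => ε y)); last lin_tac.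
transitivity (lam (L * x)); last by rewrite integral_r linearZ /= lamL /GRing.scale /= mulr1.
rewrite -[RHS](counit_r HH (fun y => lam (y * x))); last lin_tac.
by apply: eq_tlift => a b; rewrite /GRing.scale /= mulrC.
Qed.

Lemma ten_antipode W (F : H -> H -> W) x : bilinear_map F ->
  tlift F (Δ (s x)) = \ten_(a, b <- Δ x) F (s b) (s a).
Proof.
move=> bF; have [F1 F2] := bF.
rewrite -(integral_antipode_r (g := id)) //.
rewrite (lin_tlift (g := fun z => tlift F (Δ z))); last lin_tac.
transitivity (\ten_(a, b <- Δ L) \ten_(c, d <- Δ b) (lam (a * x) : k) *: F c d).
  apply: eq_tlift => a b; rewrite !linearZ /=.
  by rewrite (lin_tlift (g := fun z => (lam (a * x) : k) *: z)) //; lin_tac.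
rewrite -(comulA HH (fun a c d => (lam (a * x) : k) *: F c d)); last lin_tac.
transitivity (\ten_(a, b <- Δ L) \ten_(x1, x2 <- Δ x) (lam (a * x1) : k) *: F (s x2) b).
  apply: eq_tlift => a b.
  by rewrite (cointegral_mul (g := fun d => F d b)) //; lin_tac.
rewrite ten_exch; apply: eq_tlift => x1 x2.
by rewrite (integral_antipode_r (g := F (s x2))) //; lin_tac.
Qed.

(** This is [cointegral_mul] at s(x). Carrying a coproduct from one argument of λ to the other is
    what proves coassociativity of Δ_F and the first Frobenius identity. *)
Lemma cointegral_mul_antipode W (g : H -> W) x y : lin g ->
  \ten_(a, b <- Δ x) (lam (s b * y) : k) *: g a =
  \ten_(a, b <- Δ y) (lam (s x * a) : k) *: g b.
Proof.
move=> lg; have := cointegral_mul (g := fun z => g (sV z)) (s x) y.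
rewrite ten_antipode; last lin_tac; move=> E; etransitivity; last etransitivity.
- by apply: eq_tlift => a b; rewrite -[a in g a]antipodeK.
- by apply: E; lin_tac.
- by apply: eq_tlift => a b; rewrite antipodeK.
Qed.

Lemma integral_dual W (g : H -> W) y : lin g ->
  \ten_(a, b <- Δ L) (lam (s b * y) : k) *: g a = g y.
Proof.
move=> lg; rewrite cointegral_mul_antipode // antipode_integral -[RHS](counit_l HH g) //.
by apply: eq_tlift => a b; rewrite integral_r linearZ /= lamL /GRing.scale /= mulr1.
Qed.

(** Expanding [x] in the dual bases gives μ(Λ_1) λ(s(Λ_2) x), where the cointegral property of μ
    collapses μ(Λ_1) Λ_2 to a scalar. *)
Lemma cointegral_unique (mu : 'Hom(H, k^o)) x :
    (forall h, \ten_(a, b <- Δ h) (mu a : k) *: b = (mu h : k) *: 1) ->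
  mu x = mu L * lam x.
Proof.
move=> Hmu; rewrite -[LHS](integral_dual (g := fun y => mu y)); last lin_tac.
transitivity (lam (s (\ten_(a, b <- Δ L) (mu a : k) *: b) * x)).
  rewrite (lin_tlift (g := fun z => lam (s z * x))); last lin_tac.
  by apply: eq_tlift => a b; rewrite linearZ /= -scalerAl linearZ /= /GRing.scale /= mulrC.
by rewrite Hmu linearZ /= antipode1 -scalerAl mul1r linearZ.
Qed.

(** A linear form r is determined by the element r(Λ_1) Λ_2, which is s(y) for both sides, viewed as
    forms in [x]. *)
Lemma cointegral_swap x y : lam (x * y) = lam (s (s y) * x).
Proof.
have P (r : H -> k^o) z : lin r ->
    r z = lam (s (\ten_(a, b <- Δ L) (r a : k) *: b) * z).
  move=> lr; rewrite (lin_tlift (g := fun t => lam (s t * z))); last lin_tac.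
  rewrite -[LHS](integral_dual (g := r)) //.
  by apply: eq_tlift => a b; rewrite linearZ /= -scalerAl linearZ /= /GRing.scale /= mulrC.
rewrite (P (fun x => lam (x * y))); last lin_tac.
rewrite [RHS](P (fun x => lam (s (s y) * x))); last lin_tac.
by rewrite (integral_antipode_r (g := id)) // (integral_antipode (g := id)).
Qed.

Lemma antipodeVM x y : sV (x * y) = sV y * sV x.
Proof. by apply: antipode_inj; rewrite antipodeM !antipodeVK. Qed.

Lemma antipodeV1 : sV 1 = 1.
Proof. by apply: antipode_inj; rewrite antipodeVK antipode1. Qed.

Lemma counit_antipodeV x : ε (sV x) = ε x.
Proof. by rewrite -[in RHS](antipodeVK x) counit_antipode. Qed.

Lemma ten_antipodeV W (F : H -> H -> W) x : bilinear_map F ->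
  tlift F (Δ (sV x)) = \ten_(a, b <- Δ x) F (sV b) (sV a).
Proof.
move=> bF; have [F1 F2] := bF; rewrite -[in RHS](antipodeVK x) ten_antipode; last lin_tac.
by apply: eq_tlift => a b; rewrite !antipodeK.
Qed.

Lemma ten_antipodeVl W (g : H -> W) h : lin g ->
  \ten_(a, b <- Δ h) g (sV b * a) = (ε h : k) *: g 1.
Proof.
move=> lg; rewrite -[in RHS]antipodeV1 -(ten_antipodel HH (fun z => g (sV z))); last lin_tac.
by apply: eq_tlift => a b; rewrite antipodeVM antipodeK.
Qed.

(** Moving h_2 to the front turns it into s^2(h_2), and s^2(h_2) s(h_1) = s(h_1 s(h_2)). This
    invariance makes Δ_F right linear. *)
Lemma cointegral_ad z h : \ten_(a, b <- Δ h) lam (s a * (z * b)) = (ε h : k) *: lam z.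
Proof.
rewrite -[in RHS](mul1r z) -[X in X * z](antipode1).
rewrite -(ten_antipoder HH (fun y => lam (s y * z))); last lin_tac.
apply: eq_tlift => a b.
by rewrite mulrA cointegral_swap antipodeM !mulrA.
Qed.

(** * Ribbon element and Fourier transform *)

Variable rb : ribbon HH.
Local Notation R := (Rmx rb).
Local Notation Rb := (Rinv rb).
Local Notation Q := (monodromy rb).
Local Notation Qb := (monodromyV rb).
Local Notation v := (rv rb).
Local Notation t := (rt rb).
Local Notation u := (drinfeld_u rb).

Lemma ten_Rinv_r W (F : H -> H -> W) : bilinear_map F ->
  tlift F Rb = \ten_(r, q <- R) F r (sV q).
Proof.
move=> bF; have [F1 F2] := bF; rewrite -(@Rinv_uniq _ _ _ rb (\ten_(r, q <- R) tens r (sV q))).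
  rewrite (lin_tlift (g := tlift _)); last lin_tac.
  by apply: eq_tlift => r q; rewrite tlift_tens.
rewrite /tmul (lin_tlift (g := tlift _)); last lin_tac.
transitivity (\ten_(r, q <- R) \ten_(a, b <- Δ q) tens r (sV b * a)).
  rewrite (ten_Rmx_comulr rb (F := fun r a b => tens r (sV b * a))); last lin_tac.
  by apply: eq_tlift => a b; rewrite tlift_tens //; lin_tac.
rewrite -(Rmx_counit rb (g := fun q => tens q 1)); last lin_tac.
by apply: eq_tlift => r q; rewrite (ten_antipodeVl (g := fun z => tens r z)) //; lin_tac.
Qed.

(** Compare the two expressions (s ⊗ id)(R) and (id ⊗ s^-1)(R) for R^-1. *)
Lemma ten_Rmx_antipode W (F : H -> H -> W) : bilinear_map F ->
  \ten_(r, q <- R) F (s r) (s q) = tlift F R.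
Proof.
move=> bF; have [F1 F2] := bF.
rewrite -(ten_Rinv rb (F := fun a b => F a (s b))); last lin_tac.
rewrite ten_Rinv_r; last lin_tac.
by apply: eq_tlift => r q; rewrite antipodeVK.
Qed.

Lemma ten_Rinv_antipode W (F : H -> H -> W) : bilinear_map F ->
  \ten_(r, q <- Rb) F (s r) (s q) = tlift F Rb.
Proof.
move=> bF; have [F1 F2] := bF.
rewrite (ten_Rinv rb (F := fun a b => F (s a) (s b))); last lin_tac.
rewrite (ten_Rmx_antipode (F := fun a b => F (s a) b)); last lin_tac.
by rewrite (ten_Rinv rb).
Qed.

Lemma ten_monodromy W (F : H -> H -> W) : bilinear_map F ->
  tlift F Q = \ten_(r, q <- R) \ten_(r', q' <- R) F (q * r') (r * q').
Proof.
move=> bF; have [F1 F2] := bF.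
by rewrite ten_mul // ten_flip //; lin_tac.
Qed.

Lemma ten_monodromyV W (F : H -> H -> W) : bilinear_map F ->
  tlift F Qb = \ten_(r, q <- Rb) \ten_(r', q' <- Rb) F (r * q') (q * r').
Proof.
move=> bF; have [F1 F2] := bF; rewrite ten_mul //.
by apply: eq_tlift => r q; rewrite ten_flip //; lin_tac.
Qed.

Lemma ten_monodromy_antipode W (F : H -> H -> W) : bilinear_map F ->
  \ten_(a, b <- Q) F (s a) (s b) = \ten_(a, b <- Q) F b a.
Proof.
move=> bF; have [F1 F2] := bF.
rewrite !ten_monodromy; [|lin_tac..].
rewrite [RHS]ten_exch.
rewrite -(ten_Rmx_antipode (F := fun r' q' => \ten_(r, q <- R) F (r * q') (q * r')));
  last lin_tac.
apply: eq_tlift => r' q'.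
rewrite -(ten_Rmx_antipode (F := fun r q => F (r * s q') (q * s r'))); last lin_tac.
by apply: eq_tlift => r q; rewrite !antipodeM.
Qed.

Lemma ten_monodromyV_antipode W (F : H -> H -> W) : bilinear_map F ->
  \ten_(a, b <- Qb) F (s a) (s b) = \ten_(a, b <- Qb) F b a.
Proof.
move=> bF; have [F1 F2] := bF.
rewrite !ten_monodromyV; [|lin_tac..].
rewrite [RHS]ten_exch.
rewrite -(ten_Rinv_antipode (F := fun r' q' => \ten_(r, q <- Rb) F (q * r') (r * q')));
  last lin_tac.
apply: eq_tlift => r' q'.
rewrite -(ten_Rinv_antipode (F := fun r q => F (q * s r') (r * s q'))); last lin_tac.
by apply: eq_tlift => r q; rewrite !antipodeM.
Qed.

Lemma ten_Rmx_comul W (F : H -> H -> W) h : bilinear_map F ->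
  \ten_(r, q <- R) \ten_(a, b <- Δ h) F (r * a) (q * b) =
  \ten_(a, b <- Δ h) \ten_(r, q <- R) F (b * r) (a * q).
Proof.
move=> bF; have [F1 F2] := bF; have := congr1 (tlift F) (Rmx_comul rb h).
by rewrite !ten_mul // ten_flip //; lin_tac.
Qed.

Lemma ten_monodromyV_comul W (F : H -> H -> W) h : bilinear_map F ->
  \ten_(r, q <- Qb) \ten_(a, b <- Δ h) F (r * a) (q * b) =
  \ten_(a, b <- Δ h) \ten_(r, q <- Qb) F (a * r) (b * q).
Proof.
move=> bF; have := congr1 (tlift F) (monodromyV_comul rb h).
by rewrite (ten_mul Qb) // (ten_mul (Δ h)).
Qed.

(** This is (id ⊗ Δ)(Q) = R_21 Q_13 R_12, obtained from both hexagon axioms. *)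
Lemma ten_monodromy_hexagon W (F : H -> H -> H -> W) : trilin F ->
  \ten_(a, b <- Q) \ten_(c, d <- Δ b) F a c d =
  \ten_(r, q <- R) \ten_(r', q' <- R) \ten_(a, b <- Q) F (q * (a * r')) (r * q') b.
Proof.
move=> tF; have [F1 F2 F3] := tF.
rewrite ten_monodromy; last lin_tac.
transitivity (\ten_(r, q <- R) \ten_(r', q' <- R) \ten_(c, d <- Δ r) \ten_(c', d' <- Δ q')
   F (q * r') (c * c') (d * d')).
  apply: eq_tlift => r q; apply: eq_tlift => r' q'.
  by rewrite (ten_comulM HH (fun c d => F (q * r') c d)) //; lin_tac.
transitivity (\ten_(r, q <- R) \ten_(c, d <- Δ r) \ten_(r', q' <- R) \ten_(c', d' <- Δ q')
   F (q * r') (c * c') (d * d')).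
  by apply: eq_tlift => r q; rewrite ten_exch.
rewrite (ten_Rmx_comull rb (F := fun c d q => \ten_(r', q' <- R) \ten_(c', d' <- Δ q')
   F (q * r') (c * c') (d * d'))); last lin_tac.
apply: eq_tlift => r q.
transitivity (\ten_(r', q' <- R) \ten_(r2, q2 <- R) \ten_(r3, q3 <- R)
   F (q * q' * (r2 * r3)) (r * q3) (r' * q2)).
  apply: eq_tlift => r' q'.
  by rewrite (ten_Rmx_comulr rb (F := fun x c d => F (q * q' * x) (r * c) (r' * d))) //; lin_tac.
transitivity (\ten_(r', q' <- R) \ten_(r3, q3 <- R) \ten_(r2, q2 <- R)
   F (q * q' * (r2 * r3)) (r * q3) (r' * q2)).
  by apply: eq_tlift => r' q'; rewrite ten_exch.
rewrite ten_exch; apply: eq_tlift => r3 q3.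
rewrite ten_monodromy; last lin_tac.
by apply: eq_tlift => r' q'; apply: eq_tlift => r2 q2; rewrite !mulrA.
Qed.

(** Insert s(h_2 s(h_3)) in front of u h_1, exchange the legs of the coproduct by R Δ = Δ^op R, and
    contract the resulting s(a) b. *)
Lemma drinfeld_u_conj h : u * h = s (s h) * u.
Proof.
transitivity (\ten_(h1, h2 <- Δ h) \ten_(r, q <- R) \ten_(a, b <- Δ h1)
    s (s h2) * (s (q * b) * (r * a))).
  transitivity (\ten_(h1, h2 <- Δ h) \ten_(a, b <- Δ h1) \ten_(r, q <- R)
    s (s h2) * (s (q * b) * (r * a))); last by apply: eq_tlift => a b; rewrite ten_exch.
  rewrite (comulA HH (fun a b h2 => \ten_(r, q <- R) s (s h2) * (s (q * b) * (r * a))));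
    last lin_tac.
  rewrite -[LHS](counit_r HH (fun h => u * h)); last lin_tac.
  apply: eq_tlift => h1 h2.
  transitivity (\ten_(b, b' <- Δ h2) s (b * s b') * (u * h1)).
    by rewrite (ten_antipoder HH (fun z => s z * (u * h1))) ?antipode1 ?mul1r //; lin_tac.
  apply: eq_tlift => b b'.
  rewrite (lin_tlift (g := fun u => s (b * s b') * (u * h1))); last lin_tac.
  by apply: eq_tlift => r q; rewrite !antipodeM !mulrA.
rewrite -[RHS](counit_l HH (fun h => s (s h) * u)); last lin_tac.
apply: eq_tlift => h1 h2.
rewrite (ten_Rmx_comul (F := fun x y => s (s h2) * (s y * x))); last lin_tac.
transitivity (\ten_(a, b <- Δ h1) \ten_(r, q <- R) s (s h2) * (s q * (s a * b) * r)).
  by apply: eq_tlift => a b; apply: eq_tlift => r q; rewrite !antipodeM !mulrA.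
rewrite ten_exch.
rewrite (lin_tlift (g := fun z => s (s h2) * z)); last lin_tac.
rewrite (lin_tlift (g := fun z => (ε h1 : k) *: z)); last lin_tac.
apply: eq_tlift => r q.
by rewrite (ten_antipodel HH (fun z => s (s h2) * (s q * z * r))) ?mulr1 //; lin_tac.
Qed.

Local Notation uV := (\ten_(a, b <- Rb) (sV b * a)).

(** The factor s^-1(b) passes u as s(b), and the product becomes the image of R R^-1 = 1 ⊗ 1 under x
    ⊗ y ↦ s(y) x. *)
Lemma drinfeld_u_inv : u * uV = 1.
Proof.
rewrite (lin_tlift (g := fun uV => u * uV)); last lin_tac.
transitivity (\ten_(a, b <- Rb) \ten_(r, q <- R) s (q * b) * (r * a)).
  apply: eq_tlift => a b; rewrite mulrA drinfeld_u_conj antipodeVK.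
  rewrite (lin_tlift (g := fun u => s b * u * a)); last lin_tac.
  by apply: eq_tlift => r q; rewrite antipodeM !mulrA.
have := congr1 (tlift (fun x y => s y * x)) (RmxV rb).
rewrite ten_mul ?tlift_tens; [|lin_tac..].
by rewrite ten_exch antipode1 mulr1.
Qed.

Lemma mulr1_comm x y : x * y = 1 -> y * x = 1.
Proof.
move=> E; have : lker (amull y) == 0%VS.
  apply/lker0P => a b; rewrite !lfunE /= => /(congr1 (fun z => x * z)).
  by rewrite !mulrA E !mul1r.
move/lker0_lfunVK => K; have := K 1; rewrite lfunE /=.
set z := (_^-1)%VF 1 => Ez; suff -> : x = z by [].
by rewrite -[x]mulr1 -Ez mulrA E mul1r.
Qed.

Lemma antipode_drinfeld_inv : s uV = \ten_(a, b <- Rb) (s a * b).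
Proof.
rewrite (lin_tlift (g := s)); last lin_tac.
by apply: eq_tlift => a b; rewrite antipodeM antipodeVK.
Qed.

(* [v^-2 = s(u^-1) u^-1], by applying [m (s ⊗ id)] to [Δ v = (v ⊗ v) Q^-1]. *)
Lemma ribbon_square : v * v * (s uV * uV) = 1.
Proof.
have := ten_antipodel HH id v (@lin_id _ _).
rewrite rv_counit scale1r rv_comul => <-.
rewrite ten_mul ?tlift_tens; [|lin_tac..].
transitivity (\ten_(c, d <- Qb) v * v * (s c * d)); last first.
  apply: eq_tlift => c d; rewrite antipodeM (rv_antipode rb) -(rv_central rb (s c)) -!mulrA.
  by rewrite [v * (s c * d)]mulrA (rv_central rb (s c)) -mulrA.
rewrite -(lin_tlift (g := fun z => v * v * z)); last lin_tac.
congr (_ * _); rewrite ten_monodromyV; last lin_tac.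
rewrite ten_exch (lin_tlift (g := fun uV => s _ * uV)); last lin_tac.
apply: eq_tlift => a' b'.
transitivity (s b' * s uV * a').
  rewrite mulrA; congr (_ * _).
  have E x : x * uV = uV * s (s x).
    rewrite -[LHS]mul1r -(mulr1_comm drinfeld_u_inv) -[LHS]mulrA [u * (_ * _)]mulrA.
    by rewrite drinfeld_u_conj -mulrA drinfeld_u_inv mulr1.
  by have := congr1 s (E (sV (sV b'))); rewrite !antipodeM !antipodeVK => ->.
rewrite antipode_drinfeld_inv (lin_tlift (g := fun z => s b' * z * a')); last lin_tac.
by apply: eq_tlift => a b; rewrite antipodeM !mulrA.
Qed.

Lemma rv_inv_central h : v^-1 * h = h * v^-1.
Proof.
have vU := rv_unit rb.
by apply: (mulrI vU); rewrite mulrA divrr // mul1r mulrA rv_central mulrK.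
Qed.

Lemma rv_inv_antipode : s v^-1 = v^-1.
Proof.
have vU := rv_unit rb; apply: (mulrI vU); rewrite divrr //.
by rewrite -{1}(rv_antipode rb) -antipodeM mulVr // antipode1.
Qed.

(** The consequence of t being group-like that is used below, derived from [ribbon_square] and the
    centrality of v^-1. *)
Lemma rt_antipode_r : t * s t = 1.
Proof.
have vU := rv_unit rb.
rewrite /rt antipodeM rv_inv_antipode.
have E : v^-1 * v^-1 = s uV * uV.
  apply: (mulrI vU); rewrite mulrA divrr // mul1r; apply: (mulrI vU).
  by rewrite divrr // mulrA ribbon_square.
transitivity (s uV * uV * (u * s u)); last first.
  rewrite -mulrA [uV * (_ * _)]mulrA (mulr1_comm drinfeld_u_inv) mul1r.
  by rewrite -antipodeM drinfeld_u_inv antipode1.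
by rewrite -E -!mulrA (rv_inv_central (v^-1 * s u)) (rv_inv_central (s u))
  (rv_inv_central (v^-1 * (u * s u))) (rv_inv_central (u * s u)) !mulrA.
Qed.
Lemma rt_antipodeV : sV t = s t.
Proof.
have E := congr1 sV rt_antipode_r.
rewrite antipodeVM antipodeK antipodeV1 in E.
by rewrite -[LHS]mul1r -(mulr1_comm rt_antipode_r) -mulrA E mulr1.
Qed.

Lemma antipode_drinfeld : s u = \ten_(r, q <- R) (r * s q).
Proof.
rewrite (lin_tlift (g := s)); last lin_tac.
rewrite -(ten_Rmx_antipode (F := fun r q => r * s q)); last lin_tac.
by apply: eq_tlift => r q; rewrite antipodeM.
Qed.

(* [R Δ(Λ) R^-1 = Δ^op(Λ)], with all legs of [R] moved to one side by
   [integral_mull] and [integral_mulr]. *)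
Lemma integral_swap_drinfeld W (F : H -> H -> W) : bilinear_map F ->
  \ten_(a, b <- Δ L) F b a = \ten_(a, b <- Δ L) F (s u * a) (b * s uV).
Proof.
move=> bF; have [F1 F2] := bF.
transitivity (\ten_(r, q <- R) \ten_(x, y <- Rb) \ten_(a, b <- Δ L)
    F (r * a * x) (q * b * y)).
  have := congr1 (tlift F) (Rmx_op rb L).
  rewrite ten_flip // (ten_mul _ Rb) // (ten_mul _ (Δ L)); last lin_tac.
  by move=> ->; apply: eq_tlift => r q; rewrite ten_exch.
rewrite antipode_drinfeld antipode_drinfeld_inv.
transitivity (\ten_(r, q <- R) \ten_(x, y <- Rb) \ten_(a, b <- Δ L)
    F (r * s q * a) (b * (s x * y))).
  apply: eq_tlift => r q; apply: eq_tlift => x y.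
  transitivity (\ten_(a, b <- Δ L) F (r * (a * x)) (q * b * y)).
    by apply: eq_tlift => a b; rewrite mulrA.
  rewrite (integral_mulr (F := fun a b => F (r * a) (q * b * y))); last lin_tac.
  transitivity (\ten_(a, b <- Δ L) F (r * a) (q * b * s x * y)).
    by apply: eq_tlift => a b; rewrite mulrA.
  rewrite (integral_mull (F := fun a b => F (r * a) (b * s x * y))); last lin_tac.
  by apply: eq_tlift => a b; rewrite !mulrA.
rewrite (lin_tlift (g := fun z => \ten_(a, b <- Δ L) F (z * a) (b * _))); last lin_tac.
apply: eq_tlift => r q.
by rewrite (lin_tlift (g := fun z => \ten_(a, b <- Δ L) F (_ * a) (b * z))) //; lin_tac.
Qed.

(** The factor [s uV] on the second leg returns to the first as [uV]; the central parts of s(u) = v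
    s(t) and u^-1 = v^-1 s(t) then cancel. *)
Lemma integral_swap W (F : H -> H -> W) : bilinear_map F ->
  \ten_(a, b <- Δ L) F b a = \ten_(a, b <- Δ L) F (s t * a * sV t) b.
Proof.
move=> bF; have [F1 F2] := bF; rewrite integral_swap_drinfeld //.
have vU := rv_unit rb.
have Eu : s u = v * s t.
  by rewrite /rt antipodeM rv_inv_antipode mulrA divrr // mul1r.
have Ew : uV = v^-1 * s t.
  rewrite -[RHS]mul1r -(mulr1_comm drinfeld_u_inv) -mulrA [u * _]mulrA.
  by rewrite rt_antipode_r mulr1.
rewrite -(integral_mulr (F := fun a b => F (s u * a) b)); last lin_tac.
apply: eq_tlift => a b; rewrite Eu Ew rt_antipodeV -!mulrA.
rewrite [a * (v^-1 * s t)](_ : _ = v^-1 * (a * s t)); last first.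
  by rewrite mulrA -rv_inv_central mulrA.
by rewrite [s t * (v^-1 * _)]mulrA -rv_inv_central -!mulrA mulVKr.
Qed.

Hypothesis lamQ : \ten_(a, b <- Q) (lam a : k) *: b = L.

(** Q^-1 commutes with Δ(h), so an adjoint action on its second leg can be traded for one on its
    first leg, which is the form of the left action on K. *)
Lemma ten_monodromyV_ad W (F : H -> H -> W) h : bilinear_map F ->
  \ten_(h1, h2 <- Δ h) \ten_(a, b <- Qb) F a (h1 * b * s h2) =
  \ten_(h1, h2 <- Δ h) \ten_(a, b <- Qb) F (s h1 * a * h2) b.
Proof.
move=> bF; have [F1 F2] := bF.
transitivity (\ten_(h1, x <- Δ h) \ten_(y, h4 <- Δ x) \ten_(h2, h3 <- Δ y)
    \ten_(a, b <- Qb) F (s h1 * h2 * a) (h3 * b * s h4)).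
  rewrite (comulA4l HH (fun h1 h2 h3 h4 => \ten_(a, b <- Qb)
    F (s h1 * h2 * a) (h3 * b * s h4))); last by rewrite /quadrilin; lin_tac.
  apply: eq_tlift => x h4.
  rewrite -[LHS](counit_l HH (fun y => \ten_(a, b <- Qb) F a (y * b * s h4))); last lin_tac.
  apply: eq_tlift => y h3.
  rewrite (ten_antipodel HH (fun z => \ten_(a, b <- Qb) F (z * a) (h3 * b * s h4))); last lin_tac.
  by congr (_ *: _); apply: eq_tlift => a b; rewrite mul1r.
transitivity (\ten_(h1, x <- Δ h) \ten_(y, h4 <- Δ x) \ten_(h2, h3 <- Δ y)
    \ten_(a, b <- Qb) F (s h1 * a * h2) (b * (h3 * s h4))).
  apply: eq_tlift => h1 x; apply: eq_tlift => y h4.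
  transitivity (\ten_(h2, h3 <- Δ y) \ten_(a, b <- Qb) F (s h1 * (h2 * a)) (h3 * b * s h4)).
    by apply: eq_tlift => h2 h3; apply: eq_tlift => a b; rewrite mulrA.
  rewrite -(ten_monodromyV_comul (F := fun a b => F (s h1 * a) (b * s h4))); last lin_tac.
  by rewrite ten_exch; do 2! [apply: eq_tlift => ? ?]; rewrite !mulrA.
rewrite (comulA4r HH (fun h1 h2 h3 h4 => \ten_(a, b <- Qb)
    F (s h1 * a * h2) (b * (h3 * s h4)))); last by rewrite /quadrilin; lin_tac.
apply: eq_tlift => h1 x.
rewrite -[RHS](counit_r HH (fun x => \ten_(a, b <- Qb) F (s h1 * a * x) b)); last lin_tac.
apply: eq_tlift => h2 y.
rewrite (ten_antipoder HH (fun z => \ten_(a, b <- Qb) F (s h1 * a * h2) (b * z))); last lin_tac.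
by congr (_ *: _); apply: eq_tlift => a b; rewrite mulr1.
Qed.

(** The map [x] ↦ λ(- x) into the dual of [H], followed by the Drinfeld map, which contracts the
    first leg of Q. *)
Definition fourier x := \ten_(a, b <- Q) (lam (a * x) : k) *: b.
Definition fourierV x := \ten_(a, b <- Qb) (lam (a * x) : k) *: b.

Lemma fourier_lin : lin fourier. Proof. by rewrite /fourier; lin_tac. Qed.
Lemma fourierV_lin : lin fourierV. Proof. by rewrite /fourierV; lin_tac. Qed.

(** Writing one R^-1 in Q^-1 as (id ⊗ s^-1)(R) and the other as (s ⊗ id)(R) surrounds Q by R_21 and
    R_12. The hexagon turns this into (id ⊗ Δ)(Q), and λ on the first leg yields Δ(Λ), so that
    [integral_antipode_r] applies. *)
Lemma fourier_fourierV x : fourier (sV (fourierV x)) = s x.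
Proof.
transitivity (\ten_(r, q <- R) \ten_(r', q' <- R) \ten_(a, b <- Q)
    (lam (q * (a * r')) : k) *: ((lam (r * q' * x) : k) *: b)).
  rewrite /fourierV (lin_tlift (g := fun z => fourier (sV z))); last by rewrite /fourier; lin_tac.
  transitivity (\ten_(a, b <- Qb) (lam (a * x) : k) *: fourier (sV b)).
    by apply: eq_tlift => a b; rewrite linearZ linZ //; apply: fourier_lin.
  rewrite (ten_monodromyV); last by rewrite /fourier; lin_tac.
  rewrite ten_Rinv_r; last by rewrite /fourier; lin_tac.
  apply: eq_tlift => r q.
  rewrite (ten_Rinv rb (F := fun r' q' => (lam (r * q' * x) : k) *: fourier (sV (sV q * r'))));
    last by rewrite /fourier; lin_tac.
  apply: eq_tlift => r' q'; rewrite antipodeVM antipodeK /fourier.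
  rewrite (lin_tlift (g := fun z => (lam (r * q' * x) : k) *: z)); last lin_tac.
  apply: eq_tlift => a b; rewrite [a * (r' * _)]mulrA (cointegral_swap (a * r')) !antipodeVK.
  by rewrite !scalerA mulrC.
rewrite -(ten_monodromy_hexagon (F := fun a c d => (lam a : k) *: ((lam (c * x) : k) *: d)));
  last lin_tac.
rewrite -[RHS](integral_antipode_r (g := id)) // -lamQ.
rewrite (lin_tlift (g := fun l => \ten_(c, d <- Δ l) (lam (c * x) : k) *: d)); last lin_tac.
apply: eq_tlift => a b; rewrite linearZ linearZ /=.
by rewrite (lin_tlift (g := fun z => (lam a : k) *: z)) //; lin_tac.
Qed.

Lemma fourierV_fourier x : fourierV (sV (fourier x)) = s x.
Proof.
have lA : lin (fun x => fourier (sV x)) by rewrite /fourier; lin_tac.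
have lB : lin (fun x => fourierV (sV x)) by rewrite /fourierV; lin_tac.
have K : cancel (fun x => fourierV (sV x)) (fun x => fourier (sV x)).
  by move=> y; rewrite fourier_fourierV antipodeVK.
by have := lin_cancel lA lB K (s x); rewrite /= antipodeK.
Qed.

Lemma monodromyV_cointegral x :
  \ten_(a, b <- Qb) (lam (s b * x) : k) *: a = sV (fourierV x).
Proof.
rewrite /fourierV (lin_tlift (g := fun z => sV z)); last lin_tac.
transitivity (\ten_(a, b <- Qb) (lam (s b * x) : k) *: sV (s a)).
  by apply: eq_tlift => a b; rewrite antipodeK.
rewrite (ten_monodromyV_antipode (F := fun a b => (lam (b * x) : k) *: sV a)); last lin_tac.
by apply: eq_tlift => a b; rewrite linearZ.
Qed.

Lemma monodromy_cointegral x :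
  \ten_(a, b <- Q) (lam (x * sV b) : k) *: a = s (fourier (sV (sV x))).
Proof.
rewrite /fourier (lin_tlift (g := s)); last lin_tac.
rewrite -(ten_monodromy_antipode (F := fun a b => (lam (x * sV a) : k) *: b)); last lin_tac.
by apply: eq_tlift => a b; rewrite antipodeK linearZ (cointegral_swap a) !antipodeVK.
Qed.

(** Replace Λ_1 by its transform followed by the inverse transform. The transform brings in Q
    together with λ(c Λ_1), and the dual bases turn s(Λ_2) into the first leg [c] of Q. *)
Lemma integral_monodromy W (F : H -> H -> W) : bilinear_map F ->
  \ten_(a, b <- Δ L) F a (s b) = \ten_(a, b <- Q) F (sV (fourierV (sV b))) a.
Proof.
move=> bF; have [F1 F2] := bF.
transitivity (\ten_(a, b <- Δ L) F (sV (fourierV (sV (fourier a)))) (s b)).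
  by apply: eq_tlift => a b; rewrite fourierV_fourier antipodeK.
transitivity (\ten_(c, d <- Q) \ten_(a, b <- Δ L)
    (lam (c * a) : k) *: F (sV (fourierV (sV d))) (s b)).
  rewrite ten_exch; apply: eq_tlift => a b; rewrite /fourier.
  rewrite (lin_tlift (g := fun z => F (sV (fourierV (sV z))) (s b)));
    last by rewrite /fourierV; lin_tac.
  apply: eq_tlift => c d; rewrite !linearZ (linZ fourierV_lin) !linearZ.
  by rewrite (linZ (f := fun z => F z (s b))) //; lin_tac.
apply: eq_tlift => c d; rewrite -[X in F _ X](antipodeVK c).
rewrite -(integral_antipode (g := fun b => F (sV (fourierV (sV d))) (s b))); last lin_tac.
by apply: eq_tlift => a b; rewrite antipodeVK.
Qed.

(** This is S-invariance at the level of Λ. After [integral_monodromy] the first slot carries two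
    inverse transforms; the transform in the second slot, unfolded through another copy of Q,
    cancels one of them. *)
Lemma integral_monodromy_fixed W (F : H -> H -> W) : bilinear_map F ->
  \ten_(a, b <- Δ L) F (sV (fourierV a)) (s (fourier (sV (sV (s b))))) = \ten_(a, b <- Δ L) F a (s b).
Proof.
move=> bF; have [F1 F2] := bF.
rewrite (integral_monodromy (F := fun a b => F (sV (fourierV a)) (s (fourier (sV (sV b))))));
  last by rewrite /fourier /fourierV; lin_tac.
rewrite integral_monodromy //.
transitivity (\ten_(x, y <- Q) \ten_(a, b <- Q)
    (lam (a * sV y) : k) *: F (sV (fourierV (sV (fourierV (sV b))))) x).
  rewrite ten_exch; apply: eq_tlift => a b; rewrite -monodromy_cointegral.
  rewrite (lin_tlift (g := fun z => F (sV (fourierV (sV (fourierV (sV b))))) z)); last lin_tac.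
  by apply: eq_tlift => x y; rewrite (linZ (f := fun z => F _ z)) //; lin_tac.
apply: eq_tlift => x y.
(* Inserting an identity on the right recreates the [fourier] sum that is already unfolded on the
   left. *)
have {2}-> : sV y = sV (fourierV (sV (fourier (sV y)))) by rewrite fourierV_fourier antipodeK.
rewrite {1}/fourier.
rewrite (lin_tlift (g := fun z => F (sV (fourierV (sV (fourierV (sV z))))) x));
  last by rewrite /fourierV; lin_tac.
apply: eq_tlift => a b; rewrite !linearZ (linZ fourierV_lin) !linearZ (linZ fourierV_lin) !linearZ.
by rewrite (linZ (f := fun z => F z x)) //; lin_tac.
Qed.

Lemma comul_rv_inv : Δ v^-1 = tmul Q (tens v^-1 v^-1).
Proof.
have vU := rv_unit rb.
have E : tmul (Δ v) (Δ v^-1) = tens 1 1 by rewrite -comulM divrr // comul1.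
rewrite -[LHS]tmul1z -(monodromyKV rb) -(tmulA Q Qb); congr (tmul _ _).
rewrite -[LHS]tmul1z; have <- : tmul (tens v^-1 v^-1) (tens v v) = tens 1 1.
  by rewrite tmul_tens mulVr.
rewrite -tmulA (tmulA (tens v v)).
by rewrite -(rv_comul rb) E tmulz1.
Qed.

(** As Δ(v^-1) = Q (v^-1 ⊗ v^-1), the cointegral property at v^-1 reads [fourier v^-1 * v^-1] =
    λ(v^-1) 1. If λ(v^-1) were 0, injectivity of [fourier] would force v^-1 = 0. *)
Lemma cointegral_rv_inv : lam v^-1 != 0.
Proof.
have vU := rv_unit rb.
apply/eqP => E; have := cointegral (g := id) v^-1 (@lin_id _ _).
rewrite E scale0r comul_rv_inv ten_mul; last lin_tac.
have -> : \ten_(a, b <- Q) \ten_(c, d <- tens v^-1 v^-1) (lam (a * c) : k) *: (b * d) =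
    fourier v^-1 * v^-1.
  rewrite /fourier (lin_tlift (g := fun z => z * v^-1)); last lin_tac.
  by apply: eq_tlift => a b; rewrite tlift_tens ?scalerAl //; lin_tac.
move/(congr1 (fun z => z * v)); rewrite mulrVK // mul0r => E0.
have := fourierV_fourier v^-1; rewrite E0 linear0 (lin0 fourierV_lin) rv_inv_antipode => /esym E1.
by have := divrr vU; rewrite E1 mulr0 => /eqP; rewrite eq_sym oner_eq0.
Qed.

(** Apply ε to λ(q_1) q_2 = Λ; both copies of R in Q disappear under the counit. *)
Lemma cointegral1 : lam 1 = ε L.
Proof.
rewrite -lamQ (lin_tlift (g := fun z => ε z)); last lin_tac.
rewrite ten_monodromy; last lin_tac.
rewrite -(Rmx_counit rb (g := fun r => lam r)); last lin_tac.
rewrite ten_exch; apply: eq_tlift => r' q'.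
rewrite -[X in lam X]mul1r -(counit_Rmx rb (g := fun x => lam (x * r'))); last lin_tac.
rewrite (lin_tlift (g := fun z => (ε q' : k) *: z)); last lin_tac.
apply: eq_tlift => r q.
by rewrite [RHS]linearZ /= counitM /GRing.scale /= mulrCA mulrA mulrC.
Qed.

(** * Semisimplicity and the integral *)

Lemma tlift_mem (U V W : vectType k) (f : U -> V -> W) z (X : {vspace W}) :
  (forall a b, f a b \in X) -> tlift f z \in X.
Proof.
by move=> fX; apply: memv_suml => i _; apply: memv_suml => j _; apply: memvZ.
Qed.

Lemma maschke : ε L != 0 -> semisimple_algebra H.
Proof.
move=> nz left_ideal U Uid.
(* The projection onto [U], averaged over Λ_1 ⊗ s(Λ_2) to become [H]-linear. The scalar makes it the
   identity on [U], because Λ_1 s(Λ_2) = ε(Λ) 1; its kernel is the complement. *)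
pose pi x := (ε L : k)^-1 *: \ten_(a, b <- Δ L) a * projv U (s b * x).
have pi_lin : lin pi by rewrite /pi; lin_tac.
have piM h x : pi (h * x) = h * pi x.
  rewrite /pi -scalerAr; congr (_ *: _).
  rewrite (lin_tlift (g := fun z => h * z)); last lin_tac.
  transitivity (\ten_(a, b <- Δ L) a * projv U (s (sV h * b) * x)).
    by apply: eq_tlift => a b; rewrite antipodeM antipodeVK mulrA.
  rewrite (integral_mull (F := fun a b => a * projv U (s b * x))); last lin_tac.
  by apply: eq_tlift => a b; rewrite antipodeVK mulrA.
have piU x : pi x \in U.
  by apply: memvZ; apply: tlift_mem => a b; apply: Uid; apply: memv_proj.
have pi_id x : x \in U -> pi x = x.
  move=> xU; rewrite /pi (_ : tlift _ _ = (ε L : k) *: x) ?scalerA ?mulVf ?scale1r //.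
  rewrite -[X in _ = _ *: X]mul1r -(ten_antipoder HH (fun z => z * x)); last lin_tac.
  by apply: eq_tlift => a b; rewrite projv_id ?mulrA //; apply: Uid.
exists (lker (linfun pi)); split.
- by move=> h x; rewrite !memv_ker !linfunE // piM => /eqP ->; rewrite mulr0.
- apply/eqP; rewrite eqEsubv subvf; apply/subvP => x _.
  apply/memv_addP; exists (pi x) => //; exists (x - pi x); last by rewrite addrC subrK.
  rewrite memv_ker linfunE // -scaleN1r addrC pi_lin scaleN1r.
  by rewrite (pi_id (pi x)) // addNr.
- apply/eqP; rewrite -subv0; apply/subvP => x; rewrite memv_cap memv_ker linfunE //.
  by case/andP=> xU; rewrite pi_id // memv0.
Qed.

(** A complement of the augmentation ideal contains [w] with ε(w) = 1, and h w - ε(h) w lies in both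
    ideals, hence is 0. Computing Λ w in two ways gives Λ = ε(Λ) w. *)
Lemma semisimple_counit_integral : semisimple_algebra H -> ε L != 0.
Proof.
move=> ss; have [|X [Xid XT X0]] := ss (lker ε).
  by move=> h x; rewrite !memv_ker counitM => /eqP ->; rewrite mulr0.
have /memv_addP[y yU [w wX Ew]] : 1 \in (lker ε + X)%VS by rewrite XT memvf.
have ew : ε w = 1.
  have := congr1 ε Ew; rewrite counit1 linearD /=.
  by move: yU; rewrite memv_ker => /eqP ->; rewrite add0r.
have wint h : h * w = (ε h : k) *: w.
  apply/eqP; rewrite -subr_eq0 -memv0 -X0 memv_cap memv_ker linearB linearZ /= counitM ew.
  rewrite /GRing.scale /= subrr eqxx /=.
  by apply: memvB; [apply: Xid|apply: memvZ].
have [L0 _] := HL; apply/eqP => E; case/negP: L0; apply/eqP.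
have := wint L; rewrite integral_r ew scale1r => ->.
by rewrite E scale0r.
Qed.

(** * The Frobenius algebra F_ω *)

Section HopfAutomorphism.
Variable om : 'AEnd(H).
Local Notation F := (Fomega HH om).
Implicit Types (p q : 'Hom(H, k^o)).
Local Notation mF := (mF HH om).
Local Notation etaF := (etaF HH om).
Local Notation epsF := (epsF HH L om).
Local Notation DeltaF := (DeltaF HH lam om).

Hypothesis HomH : is_hopf_aut HH om.

Let omM x y : om (x * y) = om x * om y. Proof. exact: rmorphM. Qed.
Let om1 : om 1 = 1. Proof. exact: rmorph1. Qed.
Let oms x : s (om x) = om (s x). Proof. by have [_ _ _ ->] := HomH. Qed.
Let omε x : ε (om x) = ε x. Proof. by have [_ _ -> _] := HomH. Qed.
Let ten_om W (G : H -> H -> W) h : bilinear_map G ->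
  tlift G (Δ (om h)) = \ten_(a, b <- Δ h) G (om a) (om b).
Proof. by move=> bG; have [_ -> _ _] := HomH; rewrite ten_map. Qed.

Lemma lactFE h p x : (lact h (p : F) : 'Hom(H, k^o)) x = p (s h * x).
Proof. exact: Fomega_lactE. Qed.

Lemma ractFE h p x : (ract (p : F) h : 'Hom(H, k^o)) x = p (x * sV (om h)).
Proof. exact: Fomega_ractE. Qed.

Lemma Fomega_bimod : is_bimod F.
Proof.
split.
- split; apply: bilin_lin => [p a b c|h a b c]; apply/lfunP => z;
    rewrite add_lfunE scale_lfunE ?lactFE ?ractFE.
  + apply: (@linE _ _ _ (fun h => p (s h * z))); lin_tac.
  + by rewrite add_lfunE scale_lfunE.
  + by rewrite add_lfunE scale_lfunE.
  + apply: (@linE _ _ _ (fun x => h (z * sV (om x)))); lin_tac.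
- move=> p; split; apply/lfunP => z; rewrite ?lactFE ?ractFE.
    by rewrite antipode1 mul1r.
  by rewrite om1 antipodeV1 mulr1.
- by move=> a b p; apply/lfunP => z; rewrite !lactFE antipodeM mulrA.
- by move=> a b p; apply/lfunP => z; rewrite !ractFE omM antipodeVM mulrA.
- by move=> a b p; apply/lfunP => z; rewrite lactFE !ractFE lactFE mulrA.
Qed.

Lemma ev2_lact2 (w : H ⊗ H) (z : F ⊗ F) y x :
  ev2 (lact2 w z : F ⊗ F) y x = \ten_(a, b <- w) ev2 z (s a * y) (s b * x).
Proof.
rewrite /lact2 /ev2 (lin_tlift (g := tlift _)); last lin_tac.
apply: eq_tlift => a b; rewrite ten_map; last lin_tac.
by apply: eq_tlift => p q; rewrite !lactFE.
Qed.

Lemma ev2_ract2 (w : H ⊗ H) (z : F ⊗ F) y x :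
  ev2 (ract2 z w : F ⊗ F) y x = \ten_(a, b <- w) ev2 z (y * sV (om a)) (x * sV (om b)).
Proof.
rewrite /ract2 /ev2 (lin_tlift (g := tlift _)); last lin_tac.
apply: eq_tlift => a b; rewrite ten_map; last lin_tac.
by apply: eq_tlift => p q; rewrite !ractFE.
Qed.

Lemma ev2_tens p q y x : ev2 (tens p q) y x = p y * q x.
Proof. by rewrite /ev2 tlift_tens //; lin_tac. Qed.

Lemma mF_hom : @is_bimod_hom _ _ (tensor_bimod HH F F) F mF.
Proof.
split=> h z; apply/lfunP => x.
- rewrite [LHS]mFE lactFE mFE.
  rewrite (ten_comulM HH (fun a b => ev2 z b a)); last by rewrite /ev2; lin_tac.
  rewrite ten_antipode; last by rewrite /ev2; lin_tac.
  by rewrite ten_exch; apply: eq_tlift => a b; rewrite ev2_lact2.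
- rewrite [LHS]mFE ractFE mFE.
  rewrite (ten_comulM HH (fun a b => ev2 z b a)); last by rewrite /ev2; lin_tac.
  apply: eq_tlift => a b; rewrite ten_antipodeV; last by rewrite /ev2; lin_tac.
  rewrite ten_om; last by rewrite /ev2; lin_tac.
  by rewrite ev2_ract2.
Qed.

Lemma etaF_hom : @is_bimod_hom _ _ (unit_bimod HH) F etaF.
Proof.
split=> h c; apply/lfunP => x; rewrite ?lactFE ?ractFE !etaFE !scale_lfunE.
  by rewrite counitM counit_antipode /GRing.scale /= mulrA (mulrC c).
by rewrite counitM counit_antipodeV omε /GRing.scale /= -mulrA (mulrC (ε h)).
Qed.

Lemma epsF_hom : @is_bimod_hom _ _ F (unit_bimod HH) epsF.
Proof.
split=> h p; rewrite !epsFE ?lactFE ?ractFE /=.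
  by rewrite integral_l linearZ /= counit_antipode.
by rewrite integral_r linearZ /= counit_antipodeV omε /GRing.scale /= mulrC.
Qed.

(** On the left the factors coming from Δ(h) meet inside λ as s(h_1 s(h_2)) and contract. On the
    right they surround the argument of λ, and [cointegral_ad] removes them. *)
Lemma DeltaF_hom : @is_bimod_hom _ _ F (tensor_bimod HH F F) DeltaF.
Proof.
split=> h p; change 'Hom(H, k^o) in (type of p); apply: ev2_eq => y x.
- rewrite DeltaFE ev2_lact2.
  transitivity (\ten_(h1, h2 <- Δ h) \ten_(c, d <- Δ (s h2)) \ten_(a, b <- Δ x)
      p (c * a) * lam (s (d * b) * (s h1 * y))); last first.
    apply: eq_tlift => h1 h2; rewrite DeltaFE.
    by rewrite (ten_comulM HH (fun a b => p a * lam (s b * (s h1 * y)))) //; lin_tac.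
  transitivity (\ten_(h1, h2 <- Δ h) \ten_(d, c <- Δ h2) \ten_(a, b <- Δ x)
      p (s c * a) * lam (s b * s (h1 * s d) * y)); last first.
    apply: eq_tlift => h1 h2; rewrite ten_antipode; last lin_tac.
    by do 2! [apply: eq_tlift => ? ?]; rewrite !antipodeM !mulrA.
  rewrite -(comulA HH (fun h1 d c => \ten_(a, b <- Δ x)
      p (s c * a) * lam (s b * s (h1 * s d) * y))); last lin_tac.
  transitivity (\ten_(x1, c <- Δ h) (ε x1 : k) *: \ten_(a, b <- Δ x) p (s c * a) * lam (s b * y)).
    rewrite (counit_l HH (fun c => \ten_(a, b <- Δ x) p (s c * a) * lam (s b * y)));
      last lin_tac.
    by apply: eq_tlift => a b; rewrite lactFE.
  apply: eq_tlift => x1 c.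
  rewrite (ten_antipoder HH (fun z => \ten_(a, b <- Δ x) p (s c * a) * lam (s b * s z * y)));
    last lin_tac.
  by congr (_ *: _); apply: eq_tlift => a b; rewrite antipode1 mulr1.
- rewrite DeltaFE ev2_ract2.
  transitivity (\ten_(h1, h2 <- Δ h) \ten_(d, c <- Δ h2) \ten_(a, b <- Δ x)
      p (a * sV (om c)) * lam (s (sV (om d)) * (s b * y * sV (om h1)))); last first.
    apply: eq_tlift => h1 h2; rewrite DeltaFE.
    rewrite (ten_comulM HH (fun a b => p a * lam (s b * (y * sV (om h1))))); last lin_tac.
    rewrite [RHS]ten_exch ten_antipodeV; last lin_tac.
    rewrite ten_om; last lin_tac.
    by do 2! [apply: eq_tlift => ? ?]; rewrite !antipodeM !mulrA.
  rewrite -(comulA HH (fun h1 d c => \ten_(a, b <- Δ x)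
      p (a * sV (om c)) * lam (s (sV (om d)) * (s b * y * sV (om h1))))); last lin_tac.
  transitivity (\ten_(x1, c <- Δ h) (ε x1 : k) *: \ten_(a, b <- Δ x)
      p (a * sV (om c)) * lam (s b * y)).
    rewrite (counit_l HH (fun c => \ten_(a, b <- Δ x) p (a * sV (om c)) * lam (s b * y)));
      last lin_tac.
    by apply: eq_tlift => a b; rewrite ractFE.
  apply: eq_tlift => x1 c; rewrite ten_exch.
  rewrite (lin_tlift (g := fun z => (ε x1 : k) *: z)); last lin_tac.
  apply: eq_tlift => a b.
  have := cointegral_ad (s b * y) (sV (om x1)).
  rewrite counit_antipodeV omε ten_antipodeV; last lin_tac.
  rewrite ten_om; last lin_tac.
  move=> E; rewrite scalerAr -E (lin_tlift (g := fun z => p (a * sV (om c)) * z)) //; lin_tac.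
Qed.

Lemma mF_assoc (z : F ⊗ F ⊗ F) : mF (tmap mF id z) = mF (tmap id mF (tassoc z)).
Proof.
apply: (lin_tens_eq (f := fun z : F ⊗ F ⊗ F => mF (tmap mF id z))
  (g := fun z : F ⊗ F ⊗ F => mF (tmap id mF (tassoc z)))) => [||w r].
- by rewrite /tmap; lin_tac.
- by rewrite /tmap /tassoc; lin_tac.
apply: (lin_tens_eq (f := fun w : F ⊗ F => mF (tmap mF id (tens w r)))
  (g := fun w : F ⊗ F => mF (tmap id mF (tassoc (tens w r))))) => [||p q].
- by rewrite /tmap; lin_tac.
- by rewrite /tmap /tassoc; lin_tac.
change 'Hom(H, k^o) in (type of p); change 'Hom(H, k^o) in (type of q).
change 'Hom(H, k^o) in (type of r).
rewrite /tmap /tassoc !tlift_tens; try lin_tac.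
apply/lfunP => x; rewrite !mFE.
transitivity (\ten_(a, b <- Δ x) \ten_(c, d <- Δ b) p d * q c * r a).
  apply: eq_tlift => a b; rewrite ev2_tens mFE.
  rewrite (lin_tlift (g := fun z => z * r a)); last lin_tac.
  by apply: eq_tlift => c d; rewrite ev2_tens.
rewrite -(comulA HH (fun a c d => p d * q c * r a)); last lin_tac.
apply: eq_tlift => a b; rewrite ev2_tens mFE.
rewrite (lin_tlift (g := fun z => p b * z)); last lin_tac.
by apply: eq_tlift => c d; rewrite ev2_tens mulrA.
Qed.

Lemma mF_unitl (a : F) : mF (tmap etaF id (tens (1 : k^o) a)) = a.
Proof.
rewrite /tmap tlift_tens; last lin_tac.
change 'Hom(H, k^o) in (type of a); apply/lfunP => x; rewrite mFE.
rewrite -[RHS](counit_r HH (fun x => a x)); last lin_tac.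
apply: eq_tlift => b c; rewrite ev2_tens etaFE scale1r.
by [].
Qed.

Lemma mF_unitr (a : F) : mF (tmap id etaF (tens a (1 : k^o))) = a.
Proof.
rewrite /tmap tlift_tens; last lin_tac.
change 'Hom(H, k^o) in (type of a); apply/lfunP => x; rewrite mFE.
rewrite -[RHS](counit_l HH (fun x => a x)); last lin_tac.
apply: eq_tlift => b c; rewrite ev2_tens etaFE scale1r.
by rewrite mulrC.
Qed.

(** Coassociativity is tested at three points: both sides become p(c) λ(s(f) y1) λ(s(d) y2) with
    [c], [f], [d] the threefold coproduct of y3. The left counit law uses s(b) Λ = ε(b) Λ and λ(Λ) =
    1, the right one the dual bases. *)
Lemma DeltaF_coalgebra : is_coalgebra DeltaF epsF.
Proof.
split=> p; change 'Hom(H, k^o) in (type of p).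
- apply: (separating_eq (separating_tens (@separating_dual _ H)
    (separating_tens (@separating_dual _ H) (@separating_dual _ H)))) => [[y1 [y2 y3]]] /=.
  have E := @ten_assoc k _ _ _ k^o (fun p q r : 'Hom(H, k^o) => p y1 * (q y2 * r y3)).
  transitivity (\ten_(w, r <- tmap DeltaF id (DeltaF p)) \ten_(p, q <- w)
    (p : 'Hom(H, k^o)) y1 * ((q : 'Hom(H, k^o)) y2 * (r : 'Hom(H, k^o)) y3)).
    rewrite -E; last lin_tac.
    apply: eq_tlift => a w; rewrite (lin_tlift (g := fun z => a y1 * z)) //; lin_tac.
  rewrite ten_map; last lin_tac.
  transitivity (\ten_(a, b <- Δ y2) ev2 (DeltaF p) a y3 * lam (s b * y1)).
    transitivity (tlift (fun p1 p2 : 'Hom(H, k^o) => ev2 (DeltaF p1) y1 y2 * p2 y3) (DeltaF p)).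
      apply: eq_tlift => p1 p2; rewrite /ev2 (lin_tlift (g := fun z => z * p2 y3)); last lin_tac.
      by apply: eq_tlift => q r; rewrite mulrA.
    transitivity (tlift (fun p1 p2 : 'Hom(H, k^o) => \ten_(a, b <- Δ y2)
        p1 a * lam (s b * y1) * p2 y3) (DeltaF p)).
      apply: eq_tlift => p1 p2; rewrite DeltaFE.
      by rewrite (lin_tlift (g := fun z => z * p2 y3)) //; lin_tac.
    rewrite ten_exch; apply: eq_tlift => a b.
    rewrite /ev2 (lin_tlift (g := fun z => z * lam (s b * y1))); last lin_tac.
    by apply: eq_tlift => p1 p2; rewrite mulrAC.
  rewrite ten_map; last lin_tac.
  transitivity (\ten_(c, d <- Δ y3) ev2 (DeltaF p) y1 c * lam (s d * y2)); last first.
    transitivity (tlift (fun p1 p2 : 'Hom(H, k^o) => p1 y1 * ev2 (DeltaF p2) y2 y3) (DeltaF p));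
      last by [].
    transitivity (tlift (fun p1 p2 : 'Hom(H, k^o) => \ten_(a, b <- Δ y3)
        p1 y1 * (p2 a * lam (s b * y2))) (DeltaF p)); last first.
      apply: eq_tlift => p1 p2; rewrite DeltaFE.
      by rewrite (lin_tlift (g := fun z => p1 y1 * z)) //; lin_tac.
    rewrite ten_exch; apply: eq_tlift => a b.
    rewrite /ev2 (lin_tlift (g := fun z => z * lam (s b * y2))); last lin_tac.
    by apply: eq_tlift => p1 p2; rewrite mulrA.
  transitivity (\ten_(c, x <- Δ y3) \ten_(f, d <- Δ x) p c * (lam (s f * y1) * lam (s d * y2))).
    transitivity (\ten_(c, x <- Δ y3) \ten_(a, b <- Δ y2)
      p c * (lam (s x * a) * lam (s b * y1))).
      rewrite ten_exch; apply: eq_tlift => a b; rewrite DeltaFE.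
      rewrite (lin_tlift (g := fun z => z * lam (s b * y1))); last lin_tac.
      by apply: eq_tlift => c d; rewrite mulrA.
    apply: eq_tlift => c x.
    have := cointegral_mul_antipode (g := fun a => lam (s a * y1)) x y2.
    move=> E2; rewrite -(lin_tlift (g := fun z => p c * z)); last lin_tac.
    rewrite -[X in p c * X]E2; last lin_tac.
    rewrite (lin_tlift (g := fun z => p c * z)); last lin_tac.
    by apply: eq_tlift => a b; rewrite [lam _ * lam _]mulrC.
  rewrite -(comulA HH (fun c f d => p c * (lam (s f * y1) * lam (s d * y2)))); last lin_tac.
  apply: eq_tlift => c d; rewrite DeltaFE.
  rewrite (lin_tlift (g := fun z => z * lam (s d * y2))); last lin_tac.
  by apply: eq_tlift => a b; rewrite mulrA.
- rewrite -[RHS](tflipK) -[LHS](tflipK); congr tflip.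
  have E (z : F ⊗ F) : tflip (tmap epsF id z) = tens (\ten_(a, b <- z) (epsF a : k) *: b) (1 : k^o).
    rewrite (lin_tlift (g := fun p => tens p (1 : k^o))); last lin_tac.
    rewrite /tflip ten_map; last lin_tac.
    apply: eq_tlift => a b; rewrite (linZ (f := fun p => tens p (1 : k^o))); last lin_tac.
    by rewrite -(linZ (f := fun c => tens b (c : k^o))) /GRing.scale /= ?mulr1 //; lin_tac.
  rewrite E; rewrite /tflip tlift_tens; last lin_tac.
  congr tens; apply/lfunP => x.
  rewrite (lin_tlift (g := fun p : 'Hom(H, k^o) => p x)); last lin_tac.
  transitivity (ev2 (DeltaF p) L x).
    by apply: eq_tlift => a b; rewrite scale_lfunE epsFE.
  rewrite DeltaFE -[RHS](counit_r HH (fun x => p x)); last lin_tac.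
  apply: eq_tlift => a b; rewrite integral_l linearZ /= lamL counit_antipode.
  by rewrite /GRing.scale /= mulr1 mulrC.
- have E (z : F ⊗ F) : tmap id epsF z = tens (\ten_(a, b <- z) (epsF b : k) *: a) (1 : k^o).
    rewrite (lin_tlift (g := fun p => tens p (1 : k^o))); last lin_tac.
    apply: eq_tlift => a b; rewrite (linZ (f := fun p => tens p (1 : k^o))); last lin_tac.
    by rewrite -(linZ (f := fun c => tens a (c : k^o))) /GRing.scale /= ?mulr1 //; lin_tac.
  rewrite E; congr tens; apply/lfunP => y.
  rewrite (lin_tlift (g := fun p : 'Hom(H, k^o) => p y)); last lin_tac.
  transitivity (ev2 (DeltaF p) y L).
    by apply: eq_tlift => a b; rewrite scale_lfunE epsFE /GRing.scale /= mulrC.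
  rewrite DeltaFE -[RHS](integral_dual (g := fun x => p x)); last lin_tac.
  by apply: eq_tlift => a b; rewrite /GRing.scale /= mulrC.
Qed.

Lemma DeltaF_frobenius (z : F ⊗ F) :
  tmap mF id (tassocV (tmap id DeltaF z)) = DeltaF (mF z) /\
  DeltaF (mF z) = tmap id mF (tassoc (tmap DeltaF id z)).
Proof.
split.
- apply: (lin_tens_eq (f := fun z : F ⊗ F => tmap mF id (tassocV (tmap id DeltaF z)))
    (g := fun z : F ⊗ F => DeltaF (mF z))) => [||p q].
  + by rewrite /tmap /tassocV; lin_tac.
  + by lin_tac.
  change 'Hom(H, k^o) in (type of p); change 'Hom(H, k^o) in (type of q).
  apply: ev2_eq => y x.
  rewrite DeltaFE [tmap id _ _]/tmap tlift_tens; last lin_tac.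
  rewrite /tassocV tlift_tens; last lin_tac.
  rewrite /tmap /ev2 (lin_tlift (g := tlift _)); last lin_tac.
  rewrite (lin_tlift (g := tlift _)); last lin_tac.
  transitivity (tlift (fun q1 q2 : 'Hom(H, k^o) => \ten_(a, b <- Δ y)
      p b * q1 a * q2 x) (DeltaF q)).
    apply: eq_tlift => q1 q2; rewrite !tlift_tens; [|lin_tac..].
    rewrite mFE (lin_tlift (g := fun z => z * q2 x)); last lin_tac.
    by apply: eq_tlift => a b; rewrite ev2_tens.
  rewrite ten_exch.
  transitivity (\ten_(c, d <- Δ x) \ten_(a, b <- Δ y) q c * (lam (s d * a) * p b)).
    rewrite [RHS]ten_exch; apply: eq_tlift => a b.
    transitivity (p b * ev2 (DeltaF q) a x).
      rewrite /ev2 (lin_tlift (g := fun z => p b * z)); last lin_tac.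
      by apply: eq_tlift => q1 q2; rewrite mulrA.
    rewrite DeltaFE (lin_tlift (g := fun z => p b * z)); last lin_tac.
    by apply: eq_tlift => c d; rewrite mulrC mulrA.
  transitivity (\ten_(c, w <- Δ x) \ten_(d, e <- Δ w) q c * (p d * lam (s e * y))).
    apply: eq_tlift => c w.
    have := cointegral_mul_antipode (g := fun a => p a) w y.
    move=> E2; rewrite -(lin_tlift (g := fun z => q c * z)); last lin_tac.
    rewrite -[X in q c * X]E2; last lin_tac.
    rewrite (lin_tlift (g := fun z => q c * z)); last lin_tac.
    by apply: eq_tlift => a b; rewrite [p a * lam _]mulrC.
  rewrite -(comulA HH (fun c d e => q c * (p d * lam (s e * y)))); last lin_tac.
  apply: eq_tlift => a b; rewrite mFE.
  rewrite (lin_tlift (g := fun z => z * lam (s b * y))); last lin_tac.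
  by apply: eq_tlift => c d; rewrite ev2_tens mulrA (mulrC (q c)).
- apply: (lin_tens_eq (f := fun z : F ⊗ F => DeltaF (mF z))
    (g := fun z : F ⊗ F => tmap id mF (tassoc (tmap DeltaF id z)))) => [||p q].
  + by lin_tac.
  + by rewrite /tmap /tassoc; lin_tac.
  change 'Hom(H, k^o) in (type of p); change 'Hom(H, k^o) in (type of q).
  apply: ev2_eq => y x.
  rewrite DeltaFE [tmap DeltaF id _]/tmap tlift_tens; last lin_tac.
  rewrite /tassoc tlift_tens; last lin_tac.
  rewrite /tmap /ev2 (lin_tlift (g := tlift _)); last lin_tac.
  rewrite (lin_tlift (g := tlift _)); last lin_tac.
  transitivity (tlift (fun p1 p2 : 'Hom(H, k^o) => \ten_(a, b <- Δ x)
      p1 y * (p2 b * q a)) (DeltaF p)); last first.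
    apply: eq_tlift => p1 p2; rewrite !tlift_tens; [|lin_tac..].
    rewrite mFE (lin_tlift (g := fun z => p1 y * z)); last lin_tac.
    by apply: eq_tlift => a b; rewrite ev2_tens.
  rewrite ten_exch.
  transitivity (\ten_(c, w <- Δ x) \ten_(d, e <- Δ w) q c * (p d * lam (s e * y))).
    rewrite -(comulA HH (fun c d e => q c * (p d * lam (s e * y)))); last lin_tac.
    apply: eq_tlift => a b; rewrite mFE.
    rewrite (lin_tlift (g := fun z => z * lam (s b * y))); last lin_tac.
    by apply: eq_tlift => c d; rewrite ev2_tens mulrA (mulrC (q c)).
  apply: eq_tlift => a b.
  transitivity (q a * ev2 (DeltaF p) y b).
    by rewrite DeltaFE (lin_tlift (g := fun z => q a * z)) //; lin_tac.
  rewrite /ev2 (lin_tlift (g := fun z => q a * z)); last lin_tac.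
  by apply: eq_tlift => p1 p2; rewrite mulrC mulrA.
Qed.

Lemma Fomega_frobenius : is_frobenius HH mF etaF DeltaF epsF.
Proof.
split; [exact: Fomega_bimod|split|split| |].
- exact: mF_hom.
- exact: etaF_hom.
- exact: DeltaF_hom.
- exact: epsF_hom.
- exact: mF_assoc.
- exact: mF_unitl.
- exact: mF_unitr.
- exact: DeltaF_coalgebra.
- exact: DeltaF_frobenius.
Qed.

Lemma mF_Delta p : mF (DeltaF p) = (lam 1 : k) *: p.
Proof.
apply/lfunP => x; rewrite mFE scale_lfunE.
transitivity (\ten_(a, b <- Δ x) \ten_(c, d <- Δ a) p c * lam (s d * b)).
  by apply: eq_tlift => a b; rewrite DeltaFE.
rewrite (comulA HH (fun c d b => p c * lam (s d * b))); last lin_tac.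
rewrite -(counit_r HH (fun x => p x)); last lin_tac.
rewrite (lin_tlift (g := fun z => (lam 1 : k) *: z)); last lin_tac.
apply: eq_tlift => a b.
rewrite (ten_antipodel HH (fun z => p a * lam z)); last lin_tac.
by rewrite /GRing.scale /= [LHS]mulrA mulrC.
Qed.

Lemma epsF_eta (c : k^o) : epsF (etaF c) = (ε L : k) *: c.
Proof. by rewrite epsFE etaFE scale_lfunE /GRing.scale /= mulrC. Qed.

Lemma Fomega_special : is_special mF etaF DeltaF epsF <-> semisimple_algebra H.
Proof.
split=> [[xi [zeta [xi0 _ Exi _]]]|/semisimple_counit_integral nz].
  apply: maschke; have := Exi 1; rewrite epsF_eta /GRing.scale /= !mulr1.
  by move=> ->.
(* The second constant is λ(1), which [cointegral1] identifies with ε(Λ). *)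
exists (ε L), (ε L); split=> // [c|p]; first exact: epsF_eta.
by rewrite mF_Delta cointegral1.
Qed.

End HopfAutomorphism.

(** * Ribbon automorphisms and modular invariance *)

Section RibbonAutomorphism.
Variable om : 'AEnd(H).
Hypothesis Hom : is_ribbon_aut rb om.

Let omM x y : om (x * y) = om x * om y. Proof. exact: rmorphM. Qed.
Let om1 : om 1 = 1. Proof. exact: rmorph1. Qed.
Let oms x : s (om x) = om (s x). Proof. by have [[_ _ _ ->]] := Hom. Qed.
Let omsV x : sV (om x) = om (sV x).
Proof. by apply: antipode_inj; rewrite oms !antipodeVK. Qed.
Let omv : om v = v. Proof. by have [] := Hom. Qed.
Let omvV : om v^-1 = v^-1.
Proof.
have vU := rv_unit rb.
by apply: (mulrI vU); rewrite -{1}omv -omM !divrr // om1.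
Qed.
Let om_inj : injective om. Proof. by have [[/bij_inj]] := Hom. Qed.

(* [λ ∘ ω] is a cointegral, hence a multiple of [λ]; the normalisation only
   shows that the factor is a sign, and [λ(v^-1) ≠ 0] shows that it is 1. *)
Lemma hopf_aut_cointegral x : lam (om x) = lam x.
Proof.
have vU := rv_unit rb.
have E y : lam (om y) = lam (om L) * lam y.
  have := @cointegral_unique (lam \o om)%VF y; rewrite !comp_lfunE; apply => h.
  (* After applying ω this becomes the cointegral property of λ at [om h]. *)
  apply: om_inj; rewrite (lin_tlift (g := fun z => om z)); last lin_tac.
  rewrite comp_lfunE linearZ /= om1 -(cointegral (g := id)) //.
  have [[_ -> _ _] _ _] := Hom; rewrite ten_map; last lin_tac.
  by apply: eq_tlift => a b; rewrite comp_lfunE linearZ.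
rewrite E [lam (om L)](_ : _ = 1) ?mul1r //.
by apply: (mulIf cointegral_rv_inv); rewrite -E omvV mul1r.
Qed.

Lemma hopf_aut_monodromy W (F : H -> H -> W) : bilinear_map F ->
  \ten_(a, b <- Q) F (om a) (om b) = tlift F Q.
Proof.
move=> bF; have [F1 F2] := bF; have [_ EQ _] := Hom.
have ER (F' : H -> H -> W) : bilinear_map F' ->
    \ten_(a, b <- R) F' (om a) (om b) = tlift F' R.
  by move=> bF'; rewrite -[in RHS]EQ ten_map.
rewrite !(ten_monodromy); [|lin_tac..].
rewrite -(ER (fun r q => \ten_(r', q' <- R) F (q * r') (r * q'))); last lin_tac.
apply: eq_tlift => r q; rewrite -(ER (fun r' q' => F (om q * r') (om r * q'))); last lin_tac.
by apply: eq_tlift => r' q'; rewrite !omM.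
Qed.

Let omV : H -> H := ((om : 'End(H))^-1)%VF.
Let om_ker : lker (om : 'End(H)) == 0%VS.
Proof. by apply/lker0P => a b /om_inj. Qed.
Let omK x : omV (om x) = x. Proof. exact: lker0_lfunK om_ker x. Qed.
Let omVK x : om (omV x) = x. Proof. exact: lker0_lfunVK om_ker x. Qed.
Let omV_lin : lin omV. Proof. by rewrite /omV; lin_tac. Qed.
Let omVM x y : omV (x * y) = omV x * omV y.
Proof. by apply: om_inj; rewrite omM !omVK. Qed.
Let omVs x : omV (s x) = s (omV x). Proof. by apply: om_inj; rewrite -oms !omVK. Qed.
Let omVsV x : omV (sV x) = sV (omV x). Proof. by apply: om_inj; rewrite -omsV !omVK. Qed.

Lemma fourier_hopf_aut x : fourier (om x) = om (fourier x).
Proof.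
rewrite /fourier -(hopf_aut_monodromy (F := fun a b => (lam (a * om x) : k) *: b));
  last lin_tac.
rewrite (lin_tlift (g := fun z => om z)); last lin_tac.
by apply: eq_tlift => a b; rewrite -omM hopf_aut_cointegral linearZ.
Qed.

(* The value of [t_Q(Δ_F)(f)] at [y], where [phi a c = f (a ⊗ c)]; see
   [partial_mono_trace_Delta]. *)
Definition torus_form (phi : H -> H -> k^o) (y : H) : k^o :=
  \ten_(y1, y2 <- Δ y) \ten_(a, b <- Qb) \ten_(c, d <- Q)
    phi a c * lam (s y1 * s b * y2 * sV (om d)).

(** At y = s(h) the element inside λ contains s(h_1 b s(h_2)), so [ten_monodromyV_ad] moves [h] to
    the other leg of Q^-1, and [integral_monodromy] recognises what remains. Nothing is lost, since
    the antipode is bijective. *)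
Lemma torus_form_integral phi h : bilinear_map phi ->
  torus_form phi (s h) =
  \ten_(h1, h2 <- Δ h) \ten_(p, q <- Δ L) phi (s h1 * p * h2) (omV (s q)).
Proof.
move=> bphi; have [phi1 phi2] := bphi.
rewrite /torus_form ten_antipode; last lin_tac.
transitivity (\ten_(h1, h2 <- Δ h) \ten_(a, b <- Qb) \ten_(c, d <- Q)
    phi a c * lam (s (h1 * b * s h2) * sV (om d))).
  do 3! [apply: eq_tlift => ? ?]; by rewrite !antipodeM !mulrA.
rewrite (ten_monodromyV_ad (F := fun a b => \ten_(c, d <- Q)
    phi a c * lam (s b * sV (om d)))); last lin_tac.
apply: eq_tlift => h1 h2; rewrite ten_exch.
rewrite (integral_monodromy (F := fun p q => phi (s h1 * p * h2) (omV q))); last lin_tac.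
(* Applying ω to both legs of Q cancels ω^-1 on the first and produces the [om d] of [torus_form] on
   the second. *)
rewrite -(hopf_aut_monodromy (F := fun c d =>
    phi (s h1 * sV (fourierV (sV d)) * h2) (omV c))); last by rewrite /fourierV; lin_tac.
apply: eq_tlift => c d; rewrite omK -monodromyV_cointegral.
rewrite (lin_tlift (g := fun z => phi (s h1 * z * h2) c)); last lin_tac.
apply: eq_tlift => a b; rewrite -scalerAr -scalerAl.
by rewrite (linZ (f := fun z => phi z c)); [rewrite /GRing.scale /= mulrC|lin_tac].
Qed.

(** The factor v^-1 on Λ_2 crosses to Λ_1 as s(v^-1) = v^-1 and cancels v there. *)
Lemma torus_formT phi h : bilinear_map phi ->
  torus_form (fun a c => phi (v * a) (c * v^-1)) (s h) = torus_form phi (s h).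
Proof.
move=> bphi; have [phi1 phi2] := bphi; have vU := rv_unit rb.
rewrite !torus_form_integral //; last lin_tac.
apply: eq_tlift => h1 h2.
transitivity (\ten_(p, q <- Δ L) phi (s h1 * (v * p) * h2) (omV (s (v^-1 * q)))).
  apply: eq_tlift => p q; congr phi; last by rewrite antipodeM rv_inv_antipode omVM -{2}omvV omK.
  by rewrite !mulrA rv_central.
rewrite (integral_mull (F := fun p q => phi (s h1 * (v * p) * h2) (omV (s q)))); last lin_tac.
by apply: eq_tlift => p q; rewrite rv_inv_antipode mulVKr.
Qed.

(** Summed over Δ(h), the transform on the first slot commutes with p ↦ s(h_1) p h_2, by
    [cointegral_swap] and [ten_monodromyV_ad]. The transforms then act on Λ_1 ⊗ s(Λ_2) alone, which
    they fix. *)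
Lemma torus_formS phi h : bilinear_map phi ->
  torus_form (fun a c => phi (sV (fourierV a)) (s (fourier (sV (sV c))))) (s h) = torus_form phi (s h).
Proof.
move=> bphi; have [phi1 phi2] := bphi.
rewrite !torus_form_integral //; last by rewrite /fourierV /fourier; lin_tac.
transitivity (\ten_(h1, h2 <- Δ h) \ten_(p, q <- Δ L)
    phi (s h1 * sV (fourierV p) * h2) (omV (s (fourier (sV (sV (s q))))))).
  rewrite ten_exch [RHS]ten_exch; apply: eq_tlift => p q.
  (* ω^-1 is pulled out of the transform of the second slot, since ω preserves Q and λ. *)
  have -> : s (fourier (sV (sV (omV (s q))))) = omV (s (fourier (sV (sV (s q))))).
    by apply: om_inj; rewrite omVK -oms -fourier_hopf_aut -!omsV omVK.
  set z := omV _; transitivity (\ten_(h1, h2 <- Δ h) \ten_(a, b <- Qb)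
      (lam (s (h1 * b * s h2) * p) : k) *: phi a z).
    apply: eq_tlift => h1 h2; rewrite -monodromyV_cointegral.
    rewrite (lin_tlift (g := fun x => phi x z)); last lin_tac.
    apply: eq_tlift => a b; rewrite (linZ (f := fun x => phi x z)); last lin_tac.
    by rewrite mulrA (cointegral_swap _ h2) !antipodeM !mulrA.
  rewrite (ten_monodromyV_ad (F := fun a b => (lam (s b * p) : k) *: phi a z)); last lin_tac.
  apply: eq_tlift => h1 h2; rewrite -monodromyV_cointegral.
  rewrite (lin_tlift (g := fun x => phi (s h1 * x * h2) z)); last lin_tac.
  apply: eq_tlift => a b; rewrite -scalerAr -scalerAl.
  by rewrite (linZ (f := fun x => phi x z)) //; lin_tac.
apply: eq_tlift => h1 h2.
by rewrite (integral_monodromy_fixed (F := fun p q => phi (s h1 * p * h2) (omV q))) //; lin_tac.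
Qed.

Lemma torus_form_lact phi g h : bilinear_map phi ->
  torus_form (fun a c => \ten_(g1, g2 <- Δ g) phi (s g1 * a * g2) c) (s h) =
  torus_form phi (s g * s h).
Proof.
move=> bphi; have [phi1 phi2] := bphi; rewrite -antipodeM.
rewrite !torus_form_integral //; last lin_tac.
rewrite (ten_comulM HH (fun h1 h2 => \ten_(p, q <- Δ L) phi (s h1 * p * h2) (omV (s q))));
  last lin_tac.
apply: eq_tlift => h1 h2; rewrite ten_exch; do 2! [apply: eq_tlift => ? ?].
by rewrite antipodeM !mulrA.
Qed.

(** With e = s^-2(ω(g)) the right hand side has s(e_1) and e_2 around Λ_1. Both cross to the other
    leg, where ω^-1 s turns them into the factors g_2 and s^-1(g_1) of the right action on K. *)
Lemma torus_form_ract phi g h : bilinear_map phi ->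
  torus_form (fun a c => \ten_(g1, g2 <- Δ g) phi a (g2 * c * sV g1)) (s h) =
  torus_form phi (s h * sV (om g)).
Proof.
move=> bphi; have [phi1 phi2] := bphi.
rewrite -[sV (om g)]antipodeVK -antipodeM.
rewrite !torus_form_integral //; last lin_tac.
rewrite (ten_comulM HH (fun h1 h2 => \ten_(p, q <- Δ L) phi (s h1 * p * h2) (omV (s q))));
  last lin_tac.
rewrite [RHS]ten_exch; apply: eq_tlift => h1 h2.
rewrite ten_antipodeV; last lin_tac.
rewrite ten_antipodeV; last lin_tac.
have [[_ -> _ _] _ _] := Hom; rewrite ten_map; last lin_tac.
rewrite ten_exch; apply: eq_tlift => g1 g2.
set e1 := sV (sV (om g1)); set e2 := sV (sV (om g2)).
transitivity (\ten_(p, q <- Δ L) phi (s h1 * (s e1 * p * e2) * h2) (omV (s q))); last first.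
  by apply: eq_tlift => p q; rewrite antipodeM !mulrA.
rewrite -(integral_mull (F := fun p q => phi (s h1 * (p * e2) * h2) (omV (s q)))); last lin_tac.
rewrite (integral_mulr (F := fun p q => phi (s h1 * p * h2) (omV (s (e1 * q))))); last lin_tac.
apply: eq_tlift => p q; rewrite !antipodeM !omVM; congr (phi _ _).
by rewrite !omVs !omVsV !omK !antipodeVK.
Qed.

(** * Commutativity, symmetry and the partial monodromy trace *)

Local Notation F := (Fomega HH om).
Implicit Types (p q : 'Hom(H, k^o)).
Local Notation mF := (mF HH om).
Local Notation etaF := (etaF HH om).
Local Notation epsF := (epsF HH L om).
Local Notation DeltaF := (DeltaF HH lam om).

Lemma hopf_aut_Rmx W (G : H -> H -> W) : bilinear_map G ->
  \ten_(a, b <- R) G (om a) (om b) = tlift G R.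
Proof. by move=> bG; have [_ E _] := Hom; rewrite -[in RHS]E ten_map. Qed.

Lemma hopf_aut_rt : om t = t.
Proof.
rewrite /rt omM; congr (_ * _).
  rewrite (lin_tlift (g := fun z => om z)); last lin_tac.
  rewrite [RHS]/drinfeld_u -(hopf_aut_Rmx (G := fun x y => s y * x)); last lin_tac.
  by apply: eq_tlift => r q; rewrite omM oms.
exact: omvV.
Qed.

(** The product evaluates its factors on the two legs of Δ(x), so the claim amounts to R^-1 Δ^op(x)
    R = Δ(x). Antipodes from the actions disappear because s ⊗ s fixes R and R^-1, and ω because ω ⊗
    ω fixes R. *)
Lemma Fomega_commutative : is_commutative mF rb.
Proof.
move=> z; apply/lfunP => x; rewrite !mFE.
have bF : bilinear_map (fun y x => ev2 z x y) by rewrite /ev2; lin_tac.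
have [F1 F2] := bF.
have E : tmul (tmul Rb (tflip (Δ x))) R = Δ x.
  by rewrite -tmulA -Rmx_comul tmulRbR.
transitivity (\ten_(a, b <- Δ x) \ten_(c, d <- Rb) \ten_(e, f <- R)
    ev2 z (d * a * f) (c * b * e)); last first.
  transitivity (tlift (fun y x => ev2 z x y) (tmul (tmul Rb (tflip (Δ x))) R)); last by rewrite E.
  rewrite (ten_mul _ R) // ten_mul; last by rewrite /ev2; lin_tac.
  rewrite ten_exch; apply: eq_tlift => c d.
  by rewrite ten_flip //; rewrite /ev2; lin_tac.
apply: eq_tlift => a b; rewrite ev2_lact2.
rewrite -(ten_Rinv_antipode (F := fun c d => \ten_(e, f <- R) ev2 z (d * a * f) (c * b * e)));
  last by rewrite /ev2; lin_tac.
apply: eq_tlift => c d; rewrite ev2_ract2.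
transitivity (\ten_(e, f <- R) ev2 z (s d * a * sV f) (s c * b * sV e)).
  rewrite -(hopf_aut_Rmx (G := fun e f => ev2 z (s d * a * sV f) (s c * b * sV e)));
    last by rewrite /ev2; lin_tac.
  apply: eq_tlift => e f; rewrite /ev2 ten_flip; last lin_tac.
  by apply: eq_tlift => p q; rewrite mulrC.
rewrite -(ten_Rmx_antipode (F := fun e f => ev2 z (s d * a * sV f) (s c * b * sV e)));
  last by rewrite /ev2; lin_tac.
by apply: eq_tlift => e f; rewrite !antipodeK.
Qed.

Lemma Fomega_symmetric : is_symmetric mF epsF rb.
Proof.
move=> p q; change 'Hom(H, k^o) in (type of p); change 'Hom(H, k^o) in (type of q).
rewrite !epsFE !mFE.
transitivity (\ten_(a, b <- Δ L) p b * q a).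
  by apply: eq_tlift => a b; rewrite ev2_tens.
rewrite (integral_swap (F := fun a b => p a * q b)); last lin_tac.
apply: eq_tlift => a b; rewrite ev2_tens ractFE lactFE hopf_aut_rt.
by rewrite mulrC mulrA.
Qed.

Local Notation K := (Kbimod HH).
Implicit Types (f : 'Hom(H ⊗ H, k^o)).

(* Trace of [T] in the dual bases: [p = Σ p(Λ_1) λ(s(Λ_2) -)]. *)
Lemma hom_trace (T : 'Hom(H, k^o) -> 'Hom(H, k^o)) : lin T ->
  \sum_(i < \dim (@fullv k 'Hom(H, k^o)))
    (coord (vbasis fullv) i (T (vbasis fullv)`_i) : k^o) =
  \ten_(a, b <- Δ L) T (lam \o amull (s b))%VF a.
Proof.
move=> lT; pose c i p := coord (vbasis (@fullv k 'Hom(H, k^o))) i p : k^o.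
have lc i : lin (c i) by move=> a p q; rewrite /c linearP.
have E p : p = \ten_(a, b <- Δ L) (p a : k) *: (lam \o amull (s b))%VF.
  apply/lfunP => x; rewrite (lin_tlift (g := fun r : 'Hom(H, k^o) => r x)); last lin_tac.
  rewrite -[LHS](integral_dual (g := fun x => p x)); last lin_tac.
  apply: eq_tlift => a b; rewrite scale_lfunE comp_lfunE lfunE /=.
  by rewrite /GRing.scale /= mulrC.
transitivity (\sum_(i < \dim (@fullv k 'Hom(H, k^o))) \ten_(a, b <- Δ L)
    ((vbasis (@fullv k 'Hom(H, k^o)))`_i a * c i (T (lam \o amull (s b))%VF))).
  apply: eq_bigr => i _; rewrite -/(c i _) [X in T X]E (lin_tlift (g := fun p => c i (T p)));
    last by move=> a p q; rewrite lT lc.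
  by apply: eq_tlift => a b; rewrite !linZ.
have sum_tlift n (G : 'I_n -> H -> H -> k^o) z :
    \sum_i tlift (G i) z = \ten_(a, b <- z) \sum_i G i a b.
  rewrite /tlift exchange_big /=; apply: eq_bigr => i _.
  by rewrite exchange_big /=; apply: eq_bigr => j _; rewrite scaler_sumr.
rewrite sum_tlift; apply: eq_tlift => a b.
rewrite [in RHS](coord_vbasis (memvf (T (lam \o amull (s b))%VF))).
rewrite sum_lfunE; apply: eq_bigr => i _.
by rewrite scale_lfunE /GRing.scale /= mulrC.
Qed.

Lemma mono_actFE f p x : (mono_act rb (X := F) f p : 'Hom(H, k^o)) x =
  \ten_(a, b <- Qb) \ten_(c, d <- Q) f (tens a c) * p (s b * (x * sV (om d))).
Proof.
rewrite /mono_act (lin_tlift (g := fun p : 'Hom(H, k^o) => p x)); last lin_tac.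
apply: eq_tlift => a b; rewrite (lin_tlift (g := fun p : 'Hom(H, k^o) => p x)); last lin_tac.
by apply: eq_tlift => c d; rewrite scale_lfunE ractFE lactFE.
Qed.

(** Taken in the dual bases, the trace conjugates Λ_1 by t exactly as in [integral_swap]. With the
    legs exchanged, coassociativity applies and a second use of the dual bases removes Λ. *)
Lemma partial_mono_trace_Delta f y :
  (partial_mono_trace rb DeltaF f : 'Hom(H, k^o)) y = torus_form (fun a c => f (tens a c)) y.
Proof.
rewrite partial_mono_traceE.
pose T p : 'Hom(H, k^o) := tlift (fun p1 p2 : 'Hom(H, k^o) =>
  (p1 y : k) *: (ract (lact t (p2 : F)) t : 'Hom(H, k^o)))
  (DeltaF (mono_act rb (X := F) f p)).
have mono_lin : lin (fun p => mono_act rb (X := F) f p : 'Hom(H, k^o)).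
  move=> a p q; apply/lfunP => x; rewrite add_lfunE scale_lfunE !mono_actFE.
  apply: (@linE _ _ _ (fun p : 'Hom(H, k^o) => \ten_(a, b <- Qb) \ten_(c, d <- Q)
    f (tens a c) * p (s b * (x * sV (om d))))); lin_tac.
have T_lin : lin T by move=> a p q; rewrite /T mono_lin !linearP.
transitivity (\sum_(i < \dim (@fullv k 'Hom(H, k^o)))
    (coord (vbasis fullv) i (T (vbasis fullv)`_i) : k^o)).
  rewrite sum_lfunE; apply: eq_bigr => i _.
  rewrite (lin_tlift (g := fun r : 'Hom(H, k^o) => r y)); last lin_tac.
  rewrite (lin_tlift (g := fun r => coord (vbasis fullv) i r : k^o)); last first.
    by move=> a p q; rewrite linearP.
  by apply: eq_tlift => p1 p2; rewrite scale_lfunE linearZ /= /GRing.scale /= mulrC.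
rewrite hom_trace //.
(* The value at [x] of [mono_act] applied to the dual basis form λ(s(b) -). *)
pose N b x := \ten_(a, b' <- Qb) \ten_(c, d <- Q)
  f (tens a c) * lam (s b * (s b' * (x * sV (om d)))).
have N_bilin : bilinear_map N by rewrite /N; lin_tac.
have [N1 N2] := N_bilin.
transitivity (\ten_(a, b <- Δ L) \ten_(c, d <- Δ (s t * a * sV t)) N b c * lam (s d * y)).
  apply: eq_tlift => a b; rewrite (lin_tlift (g := fun p : 'Hom(H, k^o) => p a)); last lin_tac.
  transitivity (ev2 (DeltaF (mono_act rb (X := F) f (lam \o amull (s b))%VF)) y
      (s t * a * sV t)).
    apply: eq_tlift => p1 p2; rewrite scale_lfunE ractFE lactFE hopf_aut_rt.
    by rewrite mulrA.
  rewrite DeltaFE; apply: eq_tlift => c d; congr (_ * _); rewrite mono_actFE.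
  by do 2! [apply: eq_tlift => ? ?]; rewrite comp_lfunE lfunE.
rewrite -(integral_swap (F := fun x b => \ten_(c, d <- Δ x) N b c * lam (s d * y))); last lin_tac.
rewrite -(comulA HH (fun a c d => N a c * lam (s d * y))); last lin_tac.
transitivity (\ten_(x, d <- Δ L) (lam (s d * y) : k) *: \ten_(a, c <- Δ x) N a c).
  apply: eq_tlift => x d; rewrite (lin_tlift (g := fun z => (lam (s d * y) : k) *: z)); last lin_tac.
  by apply: eq_tlift => a c; rewrite mulrC.
rewrite (integral_dual (g := fun x => \ten_(a, c <- Δ x) N a c)); last lin_tac.
by apply: eq_tlift => y1 y2; rewrite /N; do 2! [apply: eq_tlift => ? ?]; rewrite !mulrA.
Qed.

Lemma torus_form_eq (phi phi' : H -> H -> k^o) y :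
  (forall a c, phi a c = phi' a c) -> torus_form phi y = torus_form phi' y.
Proof. by move=> E; do 3! [apply: eq_tlift => ? ?]; rewrite E. Qed.

Local Notation G := (partial_mono_trace rb DeltaF).

Lemma partial_mono_trace_hom : is_bimod_hom G.
Proof.
split=> h f; change 'Hom(H ⊗ H, k^o) in (type of f); apply/lfunP => y.
- rewrite lactFE !partial_mono_trace_Delta -[y](antipodeVK y).
  rewrite -(torus_form_lact); last lin_tac.
  by apply: torus_form_eq => a c; rewrite Kbimod_lactE.
- rewrite ractFE !partial_mono_trace_Delta -[y](antipodeVK y).
  rewrite -(torus_form_ract); last lin_tac.
  by apply: torus_form_eq => a c; rewrite Kbimod_ractE.
Qed.

(** The library inverse of [A] is a true inverse once the kernel vanishes, so invariance may be
    checked with [A] itself. *)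
Lemma lfun_fixed (U V : vectType k) (g : 'Hom(U, V)) (A : 'End(U)) :
  lker A == 0%VS -> (forall u, g (A u) = g u) -> (g \o A^-1)%VF = g.
Proof.
move=> A0 gA; apply/lfunP => x; rewrite comp_lfunE.
by rewrite -[in RHS](lker0_lfunVK A0 x) gA.
Qed.

Lemma form_eq f f' : (forall a c, f (tens a c) = f' (tens a c)) -> f = f'.
Proof.
move=> E; apply/lfunP => z.
by apply: (lin_tens_eq (f := fun z => f z) (g := fun z => f' z)) => //; lin_tac.
Qed.

(** S_K splits into independent Fourier transforms of the two arguments, one through Q^-1 and one
    through Q. *)
Lemma SK_tens f a c :
  (SK rb lam f : 'Hom(H ⊗ H, k^o)) (tens a c) =
  f (tens (sV (fourierV a)) (s (fourier (sV (sV c))))).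
Proof.
rewrite SKE -monodromyV_cointegral -monodromy_cointegral.
rewrite (lin_tlift (g := fun x => f (tens x _))); last lin_tac.
apply: eq_tlift => x x'; rewrite (linZ (f := fun x => f (tens x _))); last lin_tac.
rewrite (lin_tlift (g := fun y => f (tens x y))); last lin_tac.
rewrite (lin_tlift (g := fun z : k^o => (lam (s x' * a) : k) *: z)); last lin_tac.
apply: eq_tlift => y y'; rewrite (linZ (f := fun y => f (tens x y))); last lin_tac.
by rewrite /GRing.scale /= [RHS]mulrA [RHS]mulrC mulrA.
Qed.

Lemma SK_ker0 : lker (SK rb lam) == 0%VS.
Proof.
apply/lker0P => f f' E; apply: form_eq => a c.
have {E} E x y := congr1 (fun f : 'Hom(H ⊗ H, k^o) => f (tens x y)) E.
(* The point at which the transforms in S_K return [a] and [c]. *)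
have := E (sV (fourier a)) (s (fourierV (sV (sV c)))).
by rewrite /= !SK_tens fourierV_fourier !antipodeK fourier_fourierV !antipodeVK.
Qed.

Lemma TK_ker0 : lker (TK rb) == 0%VS.
Proof.
have vU := rv_unit rb.
apply/lker0P => f f' E; apply: form_eq => a c.
have := congr1 (fun f : 'Hom(H ⊗ H, k^o) => f (tens (v^-1 * a) (c * v))) E.
by rewrite /= !TKE mulVKr // mulrK.
Qed.

Lemma DeltaF_modular_invariant : modular_invariant rb lam DeltaF.
Proof.
split; first exact: partial_mono_trace_hom.
split.
- apply: (lfun_fixed SK_ker0) => f; apply/lfunP => y.
  rewrite !partial_mono_trace_Delta -[y](antipodeVK y).
  rewrite -[RHS](torus_formS); last lin_tac.
  by apply: torus_form_eq => a c; rewrite SK_tens.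
- apply: (lfun_fixed TK_ker0) => f; apply/lfunP => y.
  rewrite !partial_mono_trace_Delta -[y](antipodeVK y).
  rewrite -[RHS](torus_formT); last lin_tac.
  by apply: torus_form_eq => a c; rewrite TKE.
- move=> f; apply/lfunP => y; have vU := rv_unit rb.
  rewrite /twist ractFE lactFE; congr (_ _).
  (* As ω fixes v^-1 and the antipode fixes v and v^-1, the twist multiplies the argument by v and
     v^-1; these cancel because v is central, so the twist is the identity on all of F_ω. *)
  rewrite omvV (rv_antipode rb).
  have -> : sV v^-1 = v^-1 by apply: antipode_inj; rewrite antipodeVK rv_inv_antipode.
  by rewrite mulrA rv_central mulrK.
Qed.

End RibbonAutomorphism.

End HopfAlgebra.

Theorem proposition6p1
    (k : closedFieldType) (char0 : [pchar k] =i pred0)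
    (H : falgType k) (HH : hopf_algebra H) (rb : ribbon HH)
    (Hfact : factorizable rb)
    (L : H) (lam : 'Hom(H, k^o))
    (HL : is_integral HH L) (Hlam : is_right_cointegral HH lam)
    (Hnorm : normalized_integrals rb L lam)
    (om : 'AEnd(H)) (Hom : is_hopf_aut HH om) :
  exists (m : 'Hom(Fomega HH om ⊗ Fomega HH om, Fomega HH om))
         (eta : 'Hom(k^o, Fomega HH om))
         (Delta : 'Hom(Fomega HH om, Fomega HH om ⊗ Fomega HH om))
         (eps : 'Hom(Fomega HH om, k^o)),
  (* (i) *)
  ([/\ forall (p q : 'Hom(H, k^o)) (x : H),
         (m (tens (p : Fomega HH om) (q : Fomega HH om)) : 'Hom(H, k^o)) x =
           tlift (fun x1 x2 : H => p x2 * q x1) (comul HH x),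
       eta (1 : k^o) = counit HH,
       forall (p : 'Hom(H, k^o)) (x y : H),
         tlift (fun p' p'' : 'Hom(H, k^o) => p' y * p'' x) (Delta p) =
           tlift (fun x1 x2 : H => p x1 * lam (antipode HH x2 * y))
             (comul HH x)
     & forall p : 'Hom(H, k^o), eps p = p L] /\
   is_frobenius HH m eta Delta eps) /\
  (* (ii); commutativity forces (om ⊗ om)(R) = R and symmetry forces om(t) = t,
     so the first clause holds exactly for ribbon automorphisms *)
  ((is_ribbon_aut rb om -> is_commutative m rb /\ is_symmetric m eps rb) /\
   (is_special m eta Delta eps <-> semisimple_algebra H)) /\
  (* (iii) *)
  (is_ribbon_aut rb om -> modular_invariant rb lam Delta).
Proof.
have [lamL lamQ] := Hnorm.
exists (mF HH om), (etaF HH om), (DeltaF HH lam om), (epsF HH L om).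
split; last split; last exact: (DeltaF_modular_invariant HL Hlam lamL lamQ).
- split; last exact: (Fomega_frobenius HL Hlam lamL Hom).
  split=> [p q x||p x y|p].
  + by rewrite mFE; apply: eq_tlift => a b; rewrite ev2_tens.
  + by rewrite etaFE scale1r.
  + exact: DeltaFE.
  + exact: epsFE.
- split=> [Hrib|]; last exact: (Fomega_special HL Hlam lamL lamQ).
  split; first exact: (Fomega_commutative HL Hlam lamL Hrib).
  exact: (Fomega_symmetric HL Hlam lamL Hrib).
Qed.
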